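(* Assume (H1), (H3) and (H6). Then the differential equation with piecewise constant argument \[ y'(t)=A(t)y(t)+B(t)y(\gamma^0(t))+f(t),\qquad t\in\mathbb{R}, \] has a unique almost periodic solution $y$. Moreover, \[ |y|_{\infty}\le K_3|f|_{\infty},\qquad K_3=\Big[\sqrt{q}\,K_0(1+|B|_\infty\theta)\frac{2K}{1-\rho}+1\Big]\sqrt{q}\,K_0\,\theta, \] where $\theta=\sup_{n\in\mathbb{Z}}(t_{n+1}-t_n)$ and $K_0=\exp(|A|_\infty\theta)$.
   Context: Let $q\in\mathbb{N}$. $|\cdot|$ denotes the Euclidean norm on every finite-dimensional space (for matrices, the Euclidean norm of the array of entries), and for $g:D\to E$, $|g|_\infty=\sup_{t\in D}|g(t)|$. Fix a real sequence $(t_n)_{n\in\mathbb{Z}}$ with $t_n<t_{n+1}$ and $t_n\to\pm\infty$ as $n\to\pm\infty$; put $t^{(k)}_n=t_{n+k}-t_n$, $J_n=[t_n,t_{n+1})$, and $\gamma^0(t)=t_n$ for $t\in J_n$. A solution of an equation $x'(t)=\tilde f(t,\dots)$ involving $\gamma^0$ means a function $x$ that is continuous on $\mathbb{R}$, differentiable except possibly at the points $t_n$ (where both one-sided derivatives exist), and satisfies the equation except possibly at the points $t_n$. A set $E\subseteq\mathbb{R}$ (or $\subseteq\mathbb{Z}$) is relatively dense if there is $l>0$ with $E\cap[m,m+l]\neq\emptyset$ for all $m\in\mathbb{R}$. For $\mathbb{A}\in\{\mathbb{R},\mathbb{Z}\}$, a continuous $g:\mathbb{A}\to E$ is almost periodic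 if for every $\varepsilon>0$ the set $\{\tau\in\mathbb{A}:|g(t+\tau)-g(t)|\le\varepsilon\ \forall t\in\mathbb{A}\}$ is relatively dense. Let $A,B:\mathbb{R}\to M_q(\mathbb{C})$ and $f:\mathbb{R}\to\mathbb{C}^q$ be locally integrable. Let $X$ be a fundamental matrix of $x'=A(t)x$ and $X(t,s)=X(t)X(s)^{-1}$. For $n\in\mathbb{Z}$, $t\in[t_n,t_{n+1}]$, let $\mathcal{J}_n(t)=I+\int_{t_n}^tX(t_n,u)B(u)\,du$, assumed throughout to be invertible for all such $n,t$; let $Z_n(t)=X(t,t_n)\mathcal{J}_n(t)$ and $H(n)=Z_n(t_{n+1})$. Hypotheses: (H1) $A$ and $B$ are almost periodic. (H2) For every $\varepsilon>0$ the set $\bigcap_{k\in\mathbb{N}}\{T\in\mathbb{Z}: |t^{(k)}_{T+n}-t^{(k)}_n|\le\varepsilon \ \forall n\in\mathbb{Z}\}$ is relatively dense. (H3) (H2) holds, and for every $\varepsilon>0$ the set $\{\tau\in\mathbb{R}: |f(t+\tau)-f(t)|\le\varepsilon\ \forall t\in\mathbb{R}\setminus\bigcup_{n}(t_n-\varepsilon,t_n+\varepsilon)\}$ is relatively dense, and there is $\delta_\varepsilon>0$ such that $|f(t'+\tau')-f(t')|\le\varepsilon$ whenever $|\tau'|\le\delta_\varepsilon$ and $t',t'+\tau'$ lie in a common interval $[t_n,t_{n+1}]$. (H6) Let $\Phi$ be a fundamental matrix of $\phi(n+1)=H(n)\phi(n)$. There are a projection $\Pi$ on $\mathbb{C}^q$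 and constants $K>0$, $0<\rho<1$ with $|\mathcal{G}(n,k)|\le K\rho^{|n-k|}$ for all $n,k\in\mathbb{Z}$, where $\mathcal{G}(n,k)=\Phi(n)\Pi\Phi(k+1)^{-1}$ if $n>k$ and $\mathcal{G}(n,k)=-\Phi(n)(I-\Pi)\Phi(k+1)^{-1}$ if $n\le k$. *)

(* Defs.v *)
From HB Require Import structures.
From mathcomp Require Import all_boot all_order all_algebra.
From mathcomp Require Import all_classical all_reals all_analysis.
From mathcomp Require Import complex.

Set Implicit Arguments.
Unset Strict Implicit.
Unset Printing Implicit Defensive.

Import Order.TTheory GRing.Theory Num.Theory.
Local Open Scope ring_scope.
Local Open Scope classical_set_scope.

Section Defs.
Variable R : realType.
Local Notation C := R[i].

Definition normF (m n : nat) (M : 'M[C]_(m, n)) : R :=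
  Num.sqrt (\sum_(i < m) \sum_(j < n) (complex.Re (M i j) ^+ 2 + complex.Im (M i j) ^+ 2)).

Definition supnormE (T : Type) (m n : nat) (g : T -> 'M[C]_(m, n)) : \bar R :=
  ereal_sup (range (fun t => (normF (g t))%:E)).

Definition supnorm (T : Type) (m n : nat) (g : T -> 'M[C]_(m, n)) : R :=
  fine (supnormE g).

Definition mcont (m n : nat) (g : R -> 'M[C]_(m, n)) : Prop :=
  forall t eps, 0 < eps -> exists2 d, 0 < d &
    forall s, `|s - t| < d -> normF (g s - g t) < eps.

Definition has_deriv (m n : nat) (g : R -> 'M[C]_(m, n)) (t : R)
    (v : 'M[C]_(m, n)) : Prop :=
  forall eps, 0 < eps -> exists2 d, 0 < d &
    forall h, 0 < `|h| < d -> normF (((h^-1)%:C)%C *: (g (t + h) - g t) - v) < eps.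

Definition has_rderiv (m n : nat) (g : R -> 'M[C]_(m, n)) (t : R)
    (v : 'M[C]_(m, n)) : Prop :=
  forall eps, 0 < eps -> exists2 d, 0 < d &
    forall h, 0 < h < d -> normF (((h^-1)%:C)%C *: (g (t + h) - g t) - v) < eps.

Definition has_lderiv (m n : nat) (g : R -> 'M[C]_(m, n)) (t : R)
    (v : 'M[C]_(m, n)) : Prop :=
  forall eps, 0 < eps -> exists2 d, 0 < d &
    forall h, - d < h < 0 -> normF (((h^-1)%:C)%C *: (g (t + h) - g t) - v) < eps.

Definition rel_dense (E : set R) : Prop :=
  exists2 l, 0 < l & forall m : R, exists2 tau, E tau & m <= tau <= m + l.

Definition rel_denseZ (E : set int) : Prop :=
  exists2 l : R, 0 < l & forall m : R, exists2 T, E T & m <= T%:~R <= m + l.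

Definition almost_periodic (m n : nat) (g : R -> 'M[C]_(m, n)) : Prop :=
  mcont g /\ forall eps, 0 < eps ->
    rel_dense [set tau | forall t, normF (g (t + tau) - g t) <= eps].

Definition loc_integrable (m n : nat) (g : R -> 'M[C]_(m, n)) : Prop :=
  forall (a b : R) (i : 'I_m) (j : 'I_n),
    (@lebesgue_measure R).-integrable `[a, b] (EFin \o (fun u => complex.Re (g u i j))) /\
    (@lebesgue_measure R).-integrable `[a, b] (EFin \o (fun u => complex.Im (g u i j))).

Definition mintegral (m n : nat) (a b : R) (g : R -> 'M[C]_(m, n)) : 'M[C]_(m, n) :=
  \matrix_(i, j)
    ((Rintegral (@lebesgue_measure R) `[a, b] (fun u => complex.Re (g u i j)))
     +i* (Rintegral (@lebesgue_measure R) `[a, b] (fun u => complex.Im (g u i j))))%C.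

Definition tk (tn : int -> R) (k : nat) (n : int) : R := tn (n + k%:Z) - tn n.

Definition H2 (tn : int -> R) : Prop :=
  forall eps : R, 0 < eps ->
    rel_denseZ [set T : int | forall (k : nat) (n : int),
                   `|tk tn k (T + n) - tk tn k n| <= eps].

Definition H3 (q : nat) (tn : int -> R) (f : R -> 'cV[C]_q) : Prop :=
  H2 tn /\
  forall eps : R, 0 < eps ->
    rel_dense [set tau | forall t,
                 (forall n, ~ (tn n - eps < t < tn n + eps)) ->
                 normF (f (t + tau) - f t) <= eps] /\
    exists2 d, 0 < d & forall t' tau', `|tau'| <= d ->
      (exists n, tn n <= t' <= tn (n + 1) /\ tn n <= t' + tau' <= tn (n + 1)) ->
      normF (f (t' + tau') - f t') <= eps.

(* solution of y' = A y + B y(gamma0 t) + f, where gamma0 t = t_n on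
   J_n = [t_n, t_{n+1}); off the points t_n, t lies in (t_n, t_{n+1}). *)
Definition is_solution (q : nat) (tn : int -> R) (A B : R -> 'M[C]_q)
    (f : R -> 'cV[C]_q) (y : R -> 'cV[C]_q) : Prop :=
  mcont y /\
  (forall (n : int) (t : R), tn n < t < tn (n + 1) ->
     has_deriv y t (A t *m y t + B t *m y (tn n) + f t)) /\
  (forall n : int, (exists v, has_lderiv y (tn n) v) /\
                   (exists v, has_rderiv y (tn n) v)).

Definition Xts (q : nat) (X : R -> 'M[C]_q) (t s : R) : 'M[C]_q :=
  X t *m invmx (X s).

Definition Jn (q : nat) (tn : int -> R) (X B : R -> 'M[C]_q) (n : int) (t : R)
  : 'M[C]_q :=
  1%:M + mintegral (tn n) t (fun u => Xts X (tn n) u *m B u).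

Definition Zn (q : nat) (tn : int -> R) (X B : R -> 'M[C]_q) (n : int) (t : R)
  : 'M[C]_q :=
  Xts X t (tn n) *m Jn tn X B n t.

Definition Hn (q : nat) (tn : int -> R) (X B : R -> 'M[C]_q) (n : int) : 'M[C]_q :=
  Zn tn X B n (tn (n + 1)).

Definition Green (q : nat) (Phi : int -> 'M[C]_q) (Pi : 'M[C]_q) (n k : int)
  : 'M[C]_q :=
  if k < n then Phi n *m Pi *m invmx (Phi (k + 1))
  else - (Phi n *m (1%:M - Pi) *m invmx (Phi (k + 1))).

Definition theta (tn : int -> R) : R :=
  fine (ereal_sup (range (fun n : int => (tn (n + 1) - tn n)%:E))).

End Defs.

(* Main.v *)
Require Import Defs.
From HB Require Import structures.
From mathcomp Require Import all_boot all_order all_algebra.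
From mathcomp Require Import all_classical all_reals all_analysis.
From mathcomp Require Import complex ring lra zify.
Set Implicit Arguments.
Unset Strict Implicit.
Unset Printing Implicit Defensive.
Import Order.TTheory GRing.Theory Num.Theory.
Import numFieldNormedType.Exports Normc.
Local Open Scope ring_scope.
Local Open Scope classical_set_scope.

(** The closed intervals in (H3) force [f] to be continuous, and then (H2) makes
    it Bohr almost periodic.  On [[t_n, t_(n+1)]] a solution is
    [y t = Z_n(t) y(t_n) + F_n(t)], where [Z_n' = A Z_n + B], [Z_n(t_n) = 1] and
    [F_n' = A F_n + f], [F_n(t_n) = 0]; so solutions correspond to sequences with
    [phi (n + 1) = H(n) phi n + F_n(t_(n+1))].  The dichotomy gives such an
    equation exactly one bounded solution, of norm at most [2 K / (1 - rho)]
    times that of the forcing, and Gronwall's inequality bounds [Z_n] and [F_n].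

    For almost periodicity let [tau] be an almost period common to [A], [B], [f]
    for which some integer [T] has [t_(n+T)] close to [t_n + tau] for all [n].
    Then [w t = y (t + tau) - y t] satisfies the homogeneous equation up to a
    small error, except within [eps] of the [t_n], where the Lipschitz bound on
    [y] is enough.  So [w] is a bounded solution of a slightly forced equation,
    and the same dichotomy estimate shows that it is small. *)

(** Two relatively dense sets may be disjoint, so knowing the almost periods of [A], [B], [f] and
    [tn] separately does not provide a common [tau]. The remedy is that each family is closed under
    differences, up to adding the errors, and contains all small shifts; [translation_family]
    isolates these properties, which are enough for a pigeonhole argument. For the switching times
    the family consists of the reals [tau] matched by some index shift, so all four families live on
    the real line. The number [sqrt q] is the Euclidean norm of the identity matrix. It does not
    arise when Gronwall's inequality is applied to the vectors [Z n t *m v] rather than to the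
    matrices [Z n t]; the bound obtained is the stated one without these factors, and it is enlarged
    only at the end, by [sqrt q >= 1] for [q > 0]. Since [A], [B] and [f] are all continuous, the
    estimates are differential inequalities; the Lebesgue integral serves only to build
    antiderivatives and to identify [Hn]. *)

Lemma sum_sqr_cauchy_schwarz (R : realDomainType) (I : finType) (u v : I -> R) :
  (\sum_i u i * v i) ^+ 2 <= (\sum_i u i ^+ 2) * (\sum_i v i ^+ 2).
Proof.
set a := \sum_i u i ^+ 2; set b := \sum_i u i * v i; set c := \sum_i v i ^+ 2.
have q l m : 0 <= l ^+ 2 * a - 2 * l * m * b + m ^+ 2 * c.
  have -> : l ^+ 2 * a - 2 * l * m * b + m ^+ 2 * c = \sum_i (l * u i - m * v i) ^+ 2.
    rewrite /a /b /c !mulr_sumr -sumrB -big_split /=.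
    by apply: eq_bigr => i _; ring.
  by apply: sumr_ge0 => i _; exact: sqr_ge0.
have a0 : 0 <= a by apply: sumr_ge0 => i _; exact: sqr_ge0.
have [a_eq0|an0] := eqVneq a 0.
  (* With [a = 0] the form takes the value [- b ^+ 4 * (c + 2)] here, and its nonnegativity forces
     [b = 0]; no division is involved. *)
  have := q (b * (c + 1)) (b ^+ 2).
  have c0 : 0 <= c by apply: sumr_ge0 => i _; exact: sqr_ge0.
  have b0 := sqr_ge0 b.
  by rewrite a_eq0 mul0r; nra.
have ap : 0 < a by rewrite lt_def an0.
have := q b a.
have -> : b ^+ 2 * a - 2 * b * a * b + a ^+ 2 * c = a * (a * c - b ^+ 2) by ring.
by rewrite pmulr_rge0// subr_ge0.
Qed.

(** * The Euclidean norm of complex matrices *)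

Section norm.
Context {R : realType}.
Local Notation C := R[i].

Section basics.
Context {m n : nat}.
Implicit Types M N : 'M[C]_(m, n).

(** The matrix becomes a real vector indexed by row, column and a Boolean for the real or imaginary
    part, so that the scalar Cauchy-Schwarz inequality applies. *)
Let cpt M (x : 'I_m * 'I_n * bool) : R :=
  if x.2 then complex.Re (M x.1.1 x.1.2) else complex.Im (M x.1.1 x.1.2).

Let normF_cpt M : normF M = Num.sqrt (\sum_x cpt M x ^+ 2).
Proof.
rewrite /normF; congr Num.sqrt.
rewrite pair_big /=.
rewrite -(pair_big predT predT (fun p b => cpt M (p, b) ^+ 2)) /=.
by apply: eq_bigr => -[i j] _; rewrite big_bool.
Qed.

Lemma normF_ge0 M : 0 <= normF M. Proof. exact: sqrtr_ge0. Qed.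

Lemma normF_sqr M :
  normF M ^+ 2 = \sum_i \sum_j (complex.Re (M i j) ^+ 2 + complex.Im (M i j) ^+ 2).
Proof.
rewrite sqr_sqrtr//; apply: sumr_ge0 => i _; apply: sumr_ge0 => j _.
by rewrite addr_ge0 ?sqr_ge0.
Qed.

Lemma normFD M N : normF (M + N) <= normF M + normF N.
Proof.
rewrite -ler_sqr ?nnegrE ?addr_ge0 ?normF_ge0// !normF_cpt.
rewrite sqrrD !sqr_sqrtr; try by apply: sumr_ge0 => i _; exact: sqr_ge0.
have -> : \sum_x cpt (M + N) x ^+ 2 =
    \sum_x cpt M x ^+ 2 + (\sum_x cpt M x * cpt N x) *+ 2 + \sum_x cpt N x ^+ 2.
  rewrite -sumrMnl -!big_split /=; apply: eq_bigr => -[[i j] b] _.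
  rewrite /cpt /= mxE; case: b; case: (M i j) => ? ?; case: (N i j) => ? ? /=; ring.
rewrite lerD2r lerD2l lerMn2r /=.
rewrite -sqrtrM; last by apply: sumr_ge0 => i _; exact: sqr_ge0.
apply: (le_trans (ler_norm _)); rewrite -sqrtr_sqr.
by apply: ler_wsqrtr; exact: sum_sqr_cauchy_schwarz.
Qed.

(** Polarization: squaring the triangle inequality leaves twice the real inner product, which is
    also what appears when a squared norm is differentiated. *)
Lemma sum_Re_Im_le M N :
  \sum_i \sum_j (complex.Re (M i j) * complex.Re (N i j) +
                 complex.Im (M i j) * complex.Im (N i j)) <= normF M * normF N.
Proof.
set ip := \sum_i _.
have E : normF (M + N) ^+ 2 = normF M ^+ 2 + 2 * ip + normF N ^+ 2.
  rewrite !normF_sqr mulr_sumr -!big_split; apply: eq_bigr => i _.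
  rewrite mulr_sumr -!big_split; apply: eq_bigr => j _.
  rewrite mxE; case: (M i j) => ? ?; case: (N i j) => ? ? /=; ring.
have : normF (M + N) ^+ 2 <= (normF M + normF N) ^+ 2.
  by rewrite ler_sqr ?nnegrE ?addr_ge0 ?normF_ge0// normFD.
rewrite E; lra.
Qed.

Lemma normFN M : normF (- M) = normF M.
Proof.
rewrite !normF_cpt; congr Num.sqrt; apply: eq_bigr => -[[i j] b] _.
by rewrite /cpt /= mxE; case: b; case: (M i j) => ? ? /=; ring.
Qed.

Lemma normF0 : normF (0 : 'M[C]_(m, n)) = 0.
Proof.
rewrite normF_cpt big1 ?sqrtr0// => -[[i j] b] _.
by rewrite /cpt /= mxE; case: b; rewrite /= expr0n.
Qed.

Lemma normFB M N : normF (M - N) <= normF M + normF N.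
Proof. by rewrite (le_trans (normFD _ _))// normFN. Qed.

Lemma normFBC M N : normF (M - N) = normF (N - M).
Proof. by rewrite -normFN opprB. Qed.

Lemma normF_dist_le M N : `|normF M - normF N| <= normF (M - N).
Proof.
have h (U V : 'M[C]_(m, n)) : normF U - normF V <= normF (U - V).
  by rewrite lerBlDr -{1}(subrK V U) normFD.
by rewrite ler_norml h andbT lerNl opprB normFBC h.
Qed.

Lemma normFZ (a : R) M : normF ((a%:C)%C *: M) = `|a| * normF M.
Proof.
rewrite !normF_cpt -sqrtr_sqr -sqrtrM ?sqr_ge0//; congr Num.sqrt.
rewrite mulr_sumr; apply: eq_bigr => -[[i j] b] _.
by rewrite /cpt /= mxE; case: b; case: (M i j) => ? ? /=; ring.
Qed.

Let ler_cpt_normF M x : `|cpt M x| <= normF M.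
Proof.
rewrite normF_cpt -sqrtr_sqr; apply: ler_wsqrtr.
rewrite [leRHS](bigD1 x) //= lerDl.
by apply: sumr_ge0 => k _; exact: sqr_ge0.
Qed.

Lemma ler_Re_normF M i j : `|complex.Re (M i j)| <= normF M.
Proof. exact: (ler_cpt_normF M (i, j, true)). Qed.

Lemma ler_Im_normF M i j : `|complex.Im (M i j)| <= normF M.
Proof. exact: (ler_cpt_normF M (i, j, false)). Qed.

Lemma normF_le_sum M :
  normF M <= \sum_i \sum_j (`|complex.Re (M i j)| + `|complex.Im (M i j)|).
Proof.
have s0 : 0 <= \sum_i \sum_j (`|complex.Re (M i j)| + `|complex.Im (M i j)|).
  by apply: sumr_ge0 => i _; apply: sumr_ge0 => j _; rewrite addr_ge0.
rewrite -ler_sqr ?nnegrE ?normF_ge0// normF_cpt.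
rewrite sqr_sqrtr; last by apply: sumr_ge0 => i _; exact: sqr_ge0.
have -> : \sum_i \sum_j (`|complex.Re (M i j)| + `|complex.Im (M i j)|) =
    \sum_x `|cpt M x|.
  rewrite pair_big /=.
  rewrite -(pair_big predT predT (fun p b => `|cpt M (p, b)|)) /=.
  by apply: eq_bigr => -[i j] _; rewrite big_bool.
rewrite expr2 mulr_suml; apply: ler_sum => x _.
rewrite -real_normK ?num_real// expr2 ler_wpM2l// (bigD1 x)//= lerDl.
by apply: sumr_ge0.
Qed.

Lemma normF_eq0 M : normF M = 0 -> M = 0.
Proof.
move=> M0; apply/matrixP => i j; rewrite mxE.
have := ler_Re_normF M i j; have := ler_Im_normF M i j.
rewrite M0 !normr_le0 => /eqP Im0 /eqP Re0.
by case: (M i j) Re0 Im0 => a b /= -> ->.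
Qed.

Lemma normF_le0 M : normF M <= 0 -> M = 0.
Proof. by move=> M0; apply/normF_eq0/eqP; rewrite eq_le M0 normF_ge0. Qed.

End basics.

(** Cauchy-Schwarz for each row of [M] against each column of [N], applied to the moduli of the
    entries. *)
Lemma normFM {m n p : nat} (M : 'M[C]_(m, n)) (N : 'M[C]_(n, p)) :
  normF (M *m N) <= normF M * normF N.
Proof.
rewrite -ler_sqr ?nnegrE ?mulr_ge0 ?normF_ge0// exprMn.
have normc2 (z : C) : normc z ^+ 2 = complex.Re z ^+ 2 + complex.Im z ^+ 2.
  by case: z => a b; rewrite /normc /= sqr_sqrtr// addr_ge0// sqr_ge0.
have normc_ge0 (z : C) : 0 <= normc z by case: z => a b; exact: sqrtr_ge0.
have normF2 (k l : nat) (U : 'M[C]_(k, l)) :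
    normF U ^+ 2 = \sum_i \sum_j normc (U i j) ^+ 2.
  by rewrite normF_sqr; apply: eq_bigr => i _; apply: eq_bigr => j _; rewrite normc2.
rewrite !normF2.
rewrite mulr_suml; apply: ler_sum => i _.
rewrite [X in _ * X]exchange_big /= mulr_sumr; apply: ler_sum => j _.
apply: le_trans (sum_sqr_cauchy_schwarz _ _).
rewrite ler_sqr ?nnegrE//; last by apply: sumr_ge0 => k _; exact: mulr_ge0.
rewrite mxE; apply: (@le_trans _ _ (\sum_k normc (M i k * N k j))).
  elim/big_rec2: _ => [|k x y _ ih]; first by rewrite normc0.
  by rewrite (le_trans (le_normcD _ _))// lerD2l.
by apply: ler_sum => k _; rewrite normcM.
Qed.

Lemma normF_sum {m n : nat} (I : Type) (r : seq I) (P : pred I) (F : I -> 'M[C]_(m, n)) :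
  normF (\sum_(i <- r | P i) F i) <= \sum_(i <- r | P i) normF (F i).
Proof.
elim/big_rec2: _ => [|k x y _ ih]; first by rewrite normF0.
by rewrite (le_trans (normFD _ _))// lerD2l.
Qed.

End norm.

(** * Matrix-valued functions of a real variable *)

Section calculus.
Context {R : realType}.
Local Notation C := R[i].

Lemma dnbhs0_lt_cvg0P (F : R -> R) :
  (forall h, 0 <= F h) ->
  (F @ (0 : R)^' --> (0 : R)) <->
  forall eps, 0 < eps -> exists2 d, 0 < d & forall h, 0 < `|h| < d -> F h < eps.
Proof.
move=> F0; split.
  move=> /cvgr0Pnorm_lt cF eps e0.
  have [d /= d0 hd] := cF _ e0; exists d => // h /andP[h0 hlt].
  have := hd h; rewrite /ball_ /= sub0r normrN => /(_ hlt).
  by rewrite -normr_gt0 => /(_ h0); rewrite ger0_norm.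
move=> H; apply/cvgr0Pnorm_lt => eps e0.
have [d d0 hd] := H _ e0.
exists d => //= h; rewrite /ball_ /= sub0r normrN => hlt hn0.
by rewrite ger0_norm//; apply: hd; rewrite normr_gt0 hn0.
Qed.

Lemma has_deriv_cvgP (m n : nat) (g : R -> 'M[C]_(m, n)) t v :
  has_deriv g t v <->
  (fun h : R => normF (((h^-1)%:C)%C *: (g (t + h) - g t) - v)) @ (0 : R)^' --> (0 : R).
Proof.
by symmetry; apply: dnbhs0_lt_cvg0P => h; exact: normF_ge0.
Qed.

Lemma squeeze_normF0 (m n : nat) (T : Type) (F : set_system T) {FF : Filter F}
  (g : T -> 'M[C]_(m, n)) (k : T -> R) :
  (forall x, normF (g x) <= k x) -> k x @[x --> F] --> (0 : R) ->
  normF (g x) @[x --> F] --> (0 : R).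
Proof.
move=> gk k0; apply: (squeeze_cvgr _ (cvg_cst (0 : R)) k0).
by apply: nearW => x; rewrite normF_ge0 gk.
Qed.

Lemma has_deriv_cst (m n : nat) (c : 'M[C]_(m, n)) t : has_deriv (fun=> c) t 0.
Proof.
by move=> eps e0; exists 1 => // h _; rewrite !subr0 subrr scaler0 normF0.
Qed.

Lemma has_derivD (m n : nat) (f g : R -> 'M[C]_(m, n)) t u v :
  has_deriv f t u -> has_deriv g t v -> has_deriv (fun s => f s + g s) t (u + v).
Proof.
move=> /has_deriv_cvgP cf /has_deriv_cvgP cg; apply/has_deriv_cvgP.
pose proof (cvgD cf cg) as cb; rewrite addr0 in cb; apply: (squeeze_normF0 _ cb) => h.
by apply: le_trans (normFD _ _); rewrite !opprD addrACA scalerDr addrACA.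
Qed.

Lemma has_derivN (m n : nat) (f : R -> 'M[C]_(m, n)) t u :
  has_deriv f t u -> has_deriv (fun s => - f s) t (- u).
Proof.
move=> hf eps e0; have [d d0 hd] := hf _ e0; exists d => [//|h hh]; have {hh} := hd h hh.
by rewrite -!opprD scalerN -opprD normFN.
Qed.

Lemma has_derivB (m n : nat) (f g : R -> 'M[C]_(m, n)) t u v :
  has_deriv f t u -> has_deriv g t v -> has_deriv (fun s => f s - g s) t (u - v).
Proof. by move=> hf /has_derivN; exact: has_derivD. Qed.

Lemma has_deriv_shift (m n : nat) (f : R -> 'M[C]_(m, n)) (tau : R) t u :
  has_deriv f (t + tau) u -> has_deriv (fun s => f (s + tau)) t u.
Proof.
move=> hf eps e0; have [d d0 hd] := hf _ e0; exists d => [//|h hh]; have {hh} := hd h hh.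
by rewrite [t + h + tau]addrAC.
Qed.

Lemma has_deriv_near (m n : nat) (f g : R -> 'M[C]_(m, n)) (a b t : R) u :
  a < t < b -> (forall s, a < s < b -> f s = g s) ->
  has_deriv f t u -> has_deriv g t u.
Proof.
move=> tab fg hf eps e0; have [d d0 hd] := hf _ e0.
exists (Num.min d (Num.min (t - a) (b - t))).
  by rewrite !lt_min d0; lra.
move=> h; rewrite !lt_min => /and4P[h0 hd1 h1 h2].
rewrite -!fg ?hd ?h0//.
have := ler_norm h; have := ler_norm (- h); rewrite normrN; lra.
Qed.

Lemma has_deriv_incr_cvg (m n : nat) (f : R -> 'M[C]_(m, n)) t u :
  has_deriv f t u -> (fun h : R => normF (f (t + h) - f t)) @ (0 : R)^' --> (0 : R).
Proof.
move=> /has_deriv_cvgP hf.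
have h0 : `|h| @[h --> (0 : R)^'] --> (0 : R).
  rewrite -[X in _ --> X](@normr0 _ R); apply: cvg_norm.
  exact: (@cvg_within _ (nbhs (0 : R))).
pose proof (cvgM h0 (cvgD hf (cvg_cst (normF u)))) as cb; rewrite mul0r in cb; apply: (squeeze_normF0 _ cb) => h.
have [->|hn0] := eqVneq h 0; first by rewrite addr0 subrr normF0 mulr_ge0// addr_ge0// normF_ge0.
pose q := ((h^-1)%:C)%C *: (f (t + h) - f t).
rewrite -[leRHS]/(`|h| * (normF (q - u) + normF u)).
have -> : f (t + h) - f t = (h%:C)%C *: q.
  by rewrite scalerA -rmorphM /= divff// scale1r.
by rewrite normFZ ler_wpM2l// -{1}(subrK u q) normFD.
Qed.

Lemma has_derivM (m n p : nat) (f : R -> 'M[C]_(m, n)) (g : R -> 'M[C]_(n, p)) t u v :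
  has_deriv f t u -> has_deriv g t v ->
  has_deriv (fun s => f s *m g s) t (u *m g t + f t *m v).
Proof.
move=> hf hg; apply/has_deriv_cvgP.
have /has_deriv_cvgP cf := hf; have /has_deriv_cvgP cg := hg.
have ig := has_deriv_incr_cvg hg.
pose b (h : R) := normF (((h^-1)%:C)%C *: (f (t + h) - f t) - u) *
    (normF (g (t + h) - g t) + normF (g t)) +
  (normF u * normF (g (t + h) - g t) +
   normF (f t) * normF (((h^-1)%:C)%C *: (g (t + h) - g t) - v)).
have : b @ (0 : R)^' --> (0 : R).
  rewrite [X in _ --> X](_ : _ =
    0 * (0 + normF (g t)) + (normF u * 0 + normF (f t) * 0)); last by ring.
  apply: cvgD; first by apply: cvgM => //; apply: cvgD => //; exact: cvg_cst.
  by apply: cvgD; apply: cvgM => //; exact: cvg_cst.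
move=> cb; apply: (squeeze_normF0 _ cb) => h; rewrite /b; set c := ((h^-1)%:C)%C.
have -> : c *: (f (t + h) *m g (t + h) - f t *m g t) - (u *m g t + f t *m v) =
    (c *: (f (t + h) - f t) - u) *m ((g (t + h) - g t) + g t) +
    (u *m (g (t + h) - g t) + f t *m (c *: (g (t + h) - g t) - v)).
  move: (f (t + h)) (g (t + h)) (f t) (g t) => f1 g1 f0 g0.
  rewrite subrK !mulmxBl !mulmxBr -!scalemxAl -!scalemxAr !mulmxBl !mulmxBr.
  by rewrite !scalerBr; apply/matrixP => i j; rewrite !mxE; ring.
apply: (le_trans (normFD _ _)); apply: lerD.
  by apply: (le_trans (normFM _ _)); rewrite ler_wpM2l ?normF_ge0 ?normFD.
by apply: (le_trans (normFD _ _)); apply: lerD; exact: normFM.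
Qed.

Lemma has_deriv_mcont (m n : nat) (f : R -> 'M[C]_(m, n)) (u : R -> 'M[C]_(m, n)) :
  (forall t, has_deriv f t (u t)) -> mcont f.
Proof.
move=> hf t eps e0; have /has_deriv_incr_cvg := hf t.
move=> /dnbhs0_lt_cvg0P-/(_ (fun=> normF_ge0 _))/(_ _ e0)[d d0 hd].
exists d => [//|s sd]; have [->|sn] := eqVneq s t; first by rewrite subrr normF0.
by have := hd (s - t); rewrite [t + _]addrC subrK normr_gt0 subr_eq0 sn sd; apply.
Qed.

Lemma has_deriv_lderiv (m n : nat) (f : R -> 'M[C]_(m, n)) t u :
  has_deriv f t u -> has_lderiv f t u.
Proof.
move=> hf eps e0; have [d d0 hd] := hf _ e0; exists d => [//|h hh]; apply: hd.
by rewrite ltr0_norm; lra.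
Qed.

Lemma has_deriv_rderiv (m n : nat) (f : R -> 'M[C]_(m, n)) t u :
  has_deriv f t u -> has_rderiv f t u.
Proof.
move=> hf eps e0; have [d d0 hd] := hf _ e0; exists d => [//|h hh]; apply: hd.
by rewrite gtr0_norm; lra.
Qed.

Lemma mcontP (m n : nat) (f : R -> 'M[C]_(m, n)) :
  mcont f <-> forall t, normF (f s - f t) @[s --> t] --> (0 : R).
Proof.
split=> [hf t|hf t eps e0].
  apply/cvgr0Pnorm_lt => eps e0; have [d d0 hd] := hf t _ e0.
  exists d => //= s; rewrite /ball_ /= distrC => /hd.
  by rewrite ger0_norm ?normF_ge0.
have /cvgr0Pnorm_lt/(_ _ e0)[d /= d0 hd] := hf t.
exists d => [//|s sd]; have := hd s; rewrite /ball_ /= distrC => /(_ sd).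
by rewrite ger0_norm ?normF_ge0.
Qed.

Lemma mcont_cst (m n : nat) (c : 'M[C]_(m, n)) : mcont (fun=> c).
Proof. by move=> t eps e0; exists 1 => // s _; rewrite subrr normF0. Qed.

Lemma mcontD (m n : nat) (f g : R -> 'M[C]_(m, n)) :
  mcont f -> mcont g -> mcont (fun s => f s + g s).
Proof.
move=> /mcontP hf /mcontP hg; apply/mcontP => t.
pose proof (cvgD (hf t) (hg t)) as cb; rewrite addr0 in cb; apply: (squeeze_normF0 _ cb) => s.
by apply: le_trans (normFD _ _); rewrite opprD addrACA.
Qed.

Lemma mcontN (m n : nat) (f : R -> 'M[C]_(m, n)) :
  mcont f -> mcont (fun s => - f s).
Proof.
move=> hf t eps e0; have [d d0 hd] := hf t _ e0; exists d => [//|s hs]; have {hs} := hd s hs.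
by rewrite -opprD normFN.
Qed.

Lemma mcontB (m n : nat) (f g : R -> 'M[C]_(m, n)) :
  mcont f -> mcont g -> mcont (fun s => f s - g s).
Proof. by move=> hf /mcontN; exact: mcontD. Qed.

Lemma mcont_shift (m n : nat) (f : R -> 'M[C]_(m, n)) (tau : R) :
  mcont f -> mcont (fun s => f (s + tau)).
Proof.
move=> hf t eps e0; have [d d0 hd] := hf (t + tau) _ e0; exists d => [//|s sd].
by apply: hd; rewrite (_ : _ - _ = s - t)//; ring.
Qed.

Lemma mcontM (m n p : nat) (f : R -> 'M[C]_(m, n)) (g : R -> 'M[C]_(n, p)) :
  mcont f -> mcont g -> mcont (fun s => f s *m g s).
Proof.
move=> /mcontP hf /mcontP hg; apply/mcontP => t.
pose proof (cvgD (cvgM (hf t) (cvgD (hg t) (cvg_cst (normF (g t)))))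
             (cvgM (cvg_cst (normF (f t))) (hg t))) as cb.
rewrite mul0r mulr0 addr0 in cb; apply: (squeeze_normF0 _ cb) => s.
have -> : f s *m g s - f t *m g t =
    (f s - f t) *m ((g s - g t) + g t) + f t *m (g s - g t).
  by rewrite subrK mulmxBl mulmxBr addrA subrK.
apply: (le_trans (normFD _ _)); apply: lerD; last exact: normFM.
by apply: (le_trans (normFM _ _)); rewrite ler_wpM2l ?normF_ge0 ?normFD.
Qed.

(** The difference of inverses is [- X(s)^-1 (X(s) - X(t)) X(t)^-1]. Its right side contains the
    unknown norm of [X(s)^-1], which the same identity bounds once [X(s)] is close to [X(t)]. *)
Lemma mcont_invmx (q : nat) (X : R -> 'M[C]_q) :
  (forall t, X t \in unitmx) -> mcont X -> mcont (fun s => invmx (X s)).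
Proof.
move=> Xu hX t eps e0; set y := normF (invmx (X t)).
have y0 : 0 <= y := normF_ge0 _.
pose c := y + 1; have c0 : 0 < c by rewrite /c; lra.
(* The first term yields [D * y <= 1/2], hence [u <= 2 * c]; the second then brings [u * D * y]
   below [eps]. *)
pose e := Num.min (2 * c)^-1 (eps / (2 * c ^+ 2)).
have [|d d0 hd] := hX t e.
  by rewrite lt_min invr_gt0 divr_gt0// ?mulr_gt0// exprn_gt0.
exists d => // s /hd; rewrite lt_min => /andP[D1 D2].
set D := normF (X s - X t) in D1 D2; have D0 : 0 <= D := normF_ge0 _.
have E : invmx (X s) - invmx (X t) = - (invmx (X s) *m (X s - X t) *m invmx (X t)).
  by rewrite mulmxBr mulVmx// mulmxBl mul1mx -mulmxA mulmxV// mulmx1 opprB.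
set u := normF (invmx (X s)); have u0 : 0 <= u := normF_ge0 _.
have B : normF (invmx (X s) - invmx (X t)) <= u * D * y.
  rewrite E normFN (le_trans (normFM _ _))// ler_wpM2r//.
  exact: normFM.
have Dc : D * c < 2^-1 by move: D1; rewrite invfM ltr_pdivlMr.
have Dcc : D * c ^+ 2 < eps / 2.
  by move: D2; rewrite invfM mulrA ltr_pdivlMr// exprn_gt0.
have uy : u <= y + u * D * y.
  rewrite -[leLHS](_ : normF (invmx (X t) + (invmx (X s) - invmx (X t))) = u); last first.
    by rewrite addrC subrK.
  by rewrite (le_trans (normFD _ _))// lerD2l.
have Dy : D * y <= 2^-1 by apply: le_trans (ltW Dc); rewrite ler_wpM2l// /c; lra.
have uD : u * (D * y) <= u * 2^-1 by rewrite ler_wpM2l.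
have u2 : u <= 2 * c by rewrite /c; lra.
apply: (le_lt_trans B); apply: (@le_lt_trans _ _ (2 * (D * c ^+ 2))); last lra.
rewrite (_ : 2 * (D * c ^+ 2) = (2 * c) * (D * c)); last by ring.
by rewrite -mulrA ler_pM// ?mulr_ge0// ler_wpM2l// /c; lra.
Qed.

End calculus.

(** * Gronwall's inequality *)

Section gronwall.
Context {R : realType}.
Local Notation C := R[i].

Lemma is_derive_dnbhsP (F : R -> R) (t l : R) :
  is_derive t (1 : R) F l <->
  (fun h : R => h^-1 * (F (t + h) - F t)) @ (0 : R)^' --> l.
Proof.
have E : (fun h : R => h^-1 *: ((F \o shift t) (h *: (1 : R)) - F t)) =
         (fun h : R => h^-1 * (F (t + h) - F t)).
  by apply/funext => h /=; rewrite /GRing.scale /= mulr1 [h + t]addrC.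
split=> [[dF <-]|cF].
  by rewrite /derive -E; exact: dF.
have dF : derivable F t 1 by rewrite /derivable E; apply/cvg_ex; exists l.
by apply: DeriveDef => //; rewrite /derive E; exact/cvg_lim.
Qed.

Section components.
Context {m n : nat}.
Implicit Types (g : R -> 'M[C]_(m, n)) (v : 'M[C]_(m, n)).

Lemma is_derive_Re g t v i j :
  has_deriv g t v ->
  is_derive t (1 : R) (fun s => complex.Re (g s i j)) (complex.Re (v i j)).
Proof.
move=> hg; apply/is_derive_dnbhsP/cvgrPdist_lt => eps e0.
have [d d0 hd] := hg _ e0; exists d => //= h; rewrite /ball_ /= sub0r normrN => hl hn.
have := hd h; rewrite hl normr_gt0 hn => /(_ isT); apply: le_lt_trans.
apply: le_trans (ler_Re_normF _ i j); rewrite distrC !mxE.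
case: (g (t + h) i j) => ? ?; case: (g t i j) => ? ?; case: (v i j) => ? ? /=.
by rewrite mul0r subr0.
Qed.

Lemma is_derive_Im g t v i j :
  has_deriv g t v ->
  is_derive t (1 : R) (fun s => complex.Im (g s i j)) (complex.Im (v i j)).
Proof.
move=> hg; apply/is_derive_dnbhsP/cvgrPdist_lt => eps e0.
have [d d0 hd] := hg _ e0; exists d => //= h; rewrite /ball_ /= sub0r normrN => hl hn.
have := hd h; rewrite hl normr_gt0 hn => /(_ isT); apply: le_lt_trans.
apply: le_trans (ler_Im_normF _ i j); rewrite distrC !mxE.
case: (g (t + h) i j) => ? ?; case: (g t i j) => ? ?; case: (v i j) => ? ? /=.
by rewrite mul0r addr0.
Qed.

Lemma has_deriv_components g t v :
  (forall i j,
    is_derive t (1 : R) (fun s => complex.Re (g s i j)) (complex.Re (v i j)) /\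
    is_derive t (1 : R) (fun s => complex.Im (g s i j)) (complex.Im (v i j))) ->
  has_deriv g t v.
Proof.
move=> H; apply/has_deriv_cvgP.
pose k (h : R) := \sum_i \sum_j
  (`|h^-1 * (complex.Re (g (t + h) i j) - complex.Re (g t i j)) - complex.Re (v i j)| +
   `|h^-1 * (complex.Im (g (t + h) i j) - complex.Im (g t i j)) - complex.Im (v i j)|).
apply: (@squeeze_normF0 _ _ _ _ _ _ _ k).
  move=> h; apply: (le_trans (normF_le_sum _)); rewrite le_eqVlt; apply/orP; left.
  apply/eqP; apply: eq_bigr => i _; apply: eq_bigr => j _; rewrite !mxE.
  case: (g (t + h) i j) => ? ?; case: (g t i j) => ? ?; case: (v i j) => ? ? /=.
  by rewrite !mul0r subr0 addr0.
rewrite [X in _ --> X](_ : _ = \sum_(i < m) \sum_(j < n) (0 : R)); last first.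
  by rewrite big1// => i _; rewrite big1.
apply: (cvg_big add_continuous) => i _; apply: (cvg_big add_continuous) => j _.
have [hr hi] := H i j.
rewrite -[X in _ --> X](addr0 0); apply: cvgD; rewrite -[X in _ --> X](@normr0 _ R);
  apply: cvg_norm.
- move/is_derive_dnbhsP: hr => hr; rewrite -[X in _ --> X](subrr (complex.Re (v i j))).
  by apply: cvgB => //; exact: cvg_cst.
- move/is_derive_dnbhsP: hi => hi; rewrite -[X in _ --> X](subrr (complex.Im (v i j))).
  by apply: cvgB => //; exact: cvg_cst.
Qed.

(** The square is differentiable even where [g] vanishes; its derivative is twice the real inner
    product of [g t] and [v]. *)
Lemma is_derive_normF_sqr g t v :
  has_deriv g t v ->
  exists2 l, is_derive t (1 : R) (fun s => normF (g s) ^+ 2) l &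
             l <= 2 * (normF (g t) * normF v).
Proof.
move=> hg.
exists (\sum_i \sum_j (2 * (complex.Re (g t i j) * complex.Re (v i j) +
                 complex.Im (g t i j) * complex.Im (v i j)))); last first.
  under eq_bigr do rewrite -mulr_sumr.
  by rewrite -mulr_sumr ler_pM2l// sum_Re_Im_le.
pose re i j (s : R) : R := complex.Re (g s i j).
pose im i j (s : R) : R := complex.Im (g s i j).
pose F i j : R -> R := re i j * re i j + im i j * im i j.
pose D i j : R := 2 * (complex.Re (g t i j) * complex.Re (v i j) +
                 complex.Im (g t i j) * complex.Im (v i j)).
have dF i j : is_derive t (1 : R) (F i j) (D i j).
  have hr : is_derive t (1 : R) (re i j) (complex.Re (v i j)) := is_derive_Re i j hg.
  have hi : is_derive t (1 : R) (im i j) (complex.Im (v i j)) := is_derive_Im i j hg.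
  have hF := is_deriveD (is_deriveM hr hr) (is_deriveM hi hi).
  by apply: (is_derive_eq hF); rewrite /D /re /im /GRing.scale /=; ring.
have -> : (fun s => normF (g s) ^+ 2) = \sum_(i < m) \sum_(j < n) F i j.
  apply/funext => s; rewrite normF_sqr fct_sumE; apply: eq_bigr => i _.
  rewrite fct_sumE; apply: eq_bigr => j _.
  by rewrite !expr2.
rewrite -/(is_derive t 1 (\sum_(i < m) \sum_(j < n) F i j) (\sum_i \sum_j D i j)).
clearbody F D.
exact: (is_derive_sum (fun i => is_derive_sum (dF i))).
Qed.

Lemma continuous_normF g : mcont g -> continuous (fun s => normF (g s)).
Proof.
move=> cg t; apply/cvgrPdist_lt => eps e0; have [d d0 hd] := cg t _ e0.
exists d => //= s; rewrite /ball_ /= distrC => /hd; apply: le_lt_trans.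
by rewrite distrC normF_dist_le.
Qed.

(** The norm is not differentiable at zeros of [g], so it is replaced by [S = sqrt (|g|^2 + e^2)],
    which satisfies [S' <= al * S + r] everywhere in the interval. *)
Lemma gronwall g (v : R -> 'M[C]_(m, n)) (a b al r : R) :
  mcont g -> 0 <= al -> 0 <= r ->
  (forall t, a < t < b -> has_deriv g t (v t)) ->
  (forall t, a < t < b -> normF (v t) <= al * normF (g t) + r) ->
  forall t, a <= t <= b -> normF (g t) <= expR (al * (t - a)) * (normF (g a) + r * (t - a)).
Proof.
move=> cg al0 r0 dg vb t /andP[]; rewrite le_eqVlt => /predU1P[<- _|at_ tb].
  by rewrite subrr !mulr0 addr0 expR0 mul1r.
apply/ler_addgt0Pr => eps e0.
(* Scaled so that the final exponential factor turns the regularization error [e] into exactly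
   [eps]. *)
pose e := eps / expR (al * (t - a)); have ep : 0 < e by rewrite divr_gt0 ?expR_gt0.
pose S s := Num.sqrt (normF (g s) ^+ 2 + e ^+ 2).
have Sarg s : 0 < normF (g s) ^+ 2 + e ^+ 2.
  by rewrite ltr_wpDl ?sqr_ge0// exprn_gt0.
have S0 s : 0 < S s by rewrite sqrtr_gt0.
have Sg s : normF (g s) <= S s.
  rewrite -[leLHS](ger0_norm (normF_ge0 _)) -sqrtr_sqr; apply: ler_wsqrtr.
  by rewrite lerDl sqr_ge0.
have Sa : S a <= normF (g a) + e.
  rewrite -ler_sqr ?nnegrE ?(addr_ge0 (normF_ge0 _) (ltW ep)) ?(ltW (S0 a))//.
  rewrite sqr_sqrtr ?(ltW (Sarg _))//.
  by have := mulr_ge0 (normF_ge0 (g a)) (ltW ep); nra.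
(* With [x] the exponential, [E' <= r * (x - 1)], and [x <= 1] to the right of [a]; so [E] does not
   increase. *)
pose E s := S s * expR (- al * (s - a)) - r * (s - a).
have dE s : s \in `]a, t[%R -> exists2 l, is_derive s (1 : R) E l & l <= 0.
  rewrite in_itv /= => /andP[as_ st].
  have sab : a < s < b by rewrite as_ (lt_le_trans st).
  have [l dl lb] := is_derive_normF_sqr (dg s sab).
  have dS : is_derive s (1 : R) S ((2 * S s)^-1 * l).
    have -> : S = Num.sqrt \o (fun s => normF (g s) ^+ 2 + e ^+ 2) by [].
    have dd : is_derive s (1 : R) (fun s => normF (g s) ^+ 2 + e ^+ 2) l.
      by rewrite -[l]addr0; apply: is_deriveD.
    have ds : is_derive (normF (g s) ^+ 2 + e ^+ 2) (1 : R) Num.sqrt (2 * S s)^-1.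
      exact: is_derive1_sqrt.
    exact: is_derive1_comp.
  have dx : is_derive s (1 : R) (fun s => expR (- al * (s - a))) (- al * expR (- al * (s - a))).
    have da : is_derive s (1 : R) (fun s => - al * (s - a)) (- al).
      by apply: is_derive_eq; rewrite /= /GRing.scale /=; ring.
    by rewrite mulrC; exact: (@is_derive1_comp _ expR).
  exists ((2 * S s)^-1 * l * expR (- al * (s - a)) +
          S s * (- al * expR (- al * (s - a))) - r).
    by rewrite /E; apply: is_derive_eq; rewrite /= /GRing.scale /=; ring.
  have x1 : expR (- al * (s - a)) <= 1.
    by rewrite -expR0 ler_expR mulNr oppr_le0 mulr_ge0// subr_ge0 ltW.
  have x0 := expR_gt0 (- al * (s - a)).
  have lS : (2 * S s)^-1 * l <= al * S s + r.
    rewrite mulrC ler_pdivrMr ?mulr_gt0//.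
    apply: (le_trans lb).
    rewrite [leRHS](_ : _ = 2 * (S s * (al * S s + r))); last by ring.
    rewrite ler_pM2l//.
    apply: (@le_trans _ _ (normF (g s) * (al * normF (g s) + r))).
      by rewrite ler_wpM2l ?normF_ge0 ?vb.
    by rewrite ler_pM ?normF_ge0 ?addr_ge0 ?mulr_ge0 ?normF_ge0 ?lerD2r ?ler_wpM2l.
  move: x0 x1 lS; set x := expR _; set y := _^-1 * l; set z := S s => x0 x1 lS.
  have : y * x <= (al * z + r) * x by rewrite ler_pM2r.
  have : r * x <= r * 1 by rewrite ler_wpM2l.
  by rewrite mulr1; lra.
have cE : continuous E.
  move=> s; apply: cvgB; apply: cvgM.
  - apply: continuous_comp; last exact: sqrt_continuous.
    apply: cvgD; last exact: cvg_cst.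
    by apply: cvgM; exact: continuous_normF.
  - apply: continuous_comp; last exact: continuous_expR.
    by apply: cvgM; [exact: cvg_cst|apply: cvgB; [exact: cvg_id|exact: cvg_cst]].
  - exact: cvg_cst.
  - by apply: cvgB; [exact: cvg_id|exact: cvg_cst].
have dE' s : s \in `]a, t[%R -> is_derive s (1 : R) E ('D_1 E s).
  by move=> /dE [l [dl <-] _]; apply: DeriveDef.
have [c cat_ EE] := MVT at_ dE' (continuous_subspaceT cE).
have [l [_ <-] l0] := dE c cat_.
have : E t <= E a.
  by rewrite -subr_le0 EE mulr_le0_ge0// subr_ge0 ltW.
rewrite /E subrr !mulr0 subr0 expR0 mulr1 lerBlDr mulNr expRN.
rewrite ler_pdivrMr ?expR_gt0// => H.
apply: (le_trans (Sg t)); apply: (le_trans H).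
have -> : eps = expR (al * (t - a)) * e by rewrite /e mulrCA divff ?gt_eqF ?expR_gt0// mulr1.
by rewrite -mulrDr mulrC ler_pM2l ?expR_gt0// addrAC lerD2r.
Qed.

End components.
End gronwall.

(** * Antiderivatives of continuous functions *)

Section antiderivative.
Context {R : realType}.
Local Notation C := R[i].
Local Notation mu := (@lebesgue_measure R).

(** The integral from [a] to [t] is differentiated in [t] only strictly to the right of [a], so a
    single base point does not serve the whole line. *)
Lemma continuous_antiderivative (g : R -> R) : continuous g ->
  exists2 G : R -> R, (forall t, is_derive t (1 : R) G (g t)) &
    forall a t, a <= t -> Rintegral mu `[a, t] g = G t - G a.
Proof.
move=> cg; pose I (a t : R) : R := Rintegral mu `[a, t] g.
have ig (a b : R) : mu.-integrable `[a, b] (EFin \o g).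
  apply: continuous_compact_integrable; first exact: segment_compact.
  by apply: continuous_subspaceT => x; exact: cg.
have dI (a t : R) : a < t -> is_derive t (1 : R) (I a) (g t).
  move=> at_; have tt : t < t + 1 by rewrite ltrDl.
  have [dF Fv] := continuous_FTC1_closed tt (ig a (t + 1)) at_ (cg t).
  by apply: DeriveDef; [exact: dF|rewrite -derive1E; exact: Fv].
have cI (a t : R) : a < t -> {for t, continuous (I a)}.
  by move=> /dI[/derivable1_diffP/differentiable_continuous + _].
have II (b a t : R) : b < a -> a <= t -> I a t = I b t - I b a.
  move=> ba; rewrite le_eqVlt => /predU1P[<-|at_].
    by rewrite subrr /I set_itv1 Rintegral_set1.
  have bt := lt_trans ba at_.
  rewrite /I /Rintegral (@continuous_FTC2 _ g (I b) a t)//.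
  - by apply: continuous_subspaceT => x; exact: cg.
  - split.
    + move=> x; rewrite in_itv /= => /andP[ax _].
      by have [] := dI _ _ (lt_trans ba ax).
    + by apply: cvg_at_right_filter; exact: cI.
    + by apply: cvg_at_left_filter; exact: cI.
  - move=> x; rewrite in_itv /= => /andP[ax _].
    by rewrite derive1E; have [_ ->] := dI _ _ (lt_trans ba ax).
(* The base point lies strictly to the left of both [t] and [0]. Subtracting the value at [0] makes
   the result independent of it ([GE]), so near a given [t] one base point can be fixed. *)
pose G (t : R) : R := I (Num.min t 0 - 1) t - I (Num.min t 0 - 1) 0.
have GE (b t : R) : b < Num.min t 0 -> G t = I b t - I b 0.
  rewrite /G; set c := Num.min t 0 - 1 => bt.
  have ct : c < Num.min t 0 by rewrite ltrBlDr ltrDl.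
  move: ct bt; rewrite !lt_min => /andP[ct c0] /andP[bt b0].
  have [bc|cb|->//] := ltgtP b c.
  - by rewrite (II b c t)// ?(II b c 0)//; [ring|exact: ltW..].
  - by rewrite (II c b t)// ?(II c b 0)//; [ring|exact: ltW..].
exists G.
  move=> t; pose b := Num.min t 0 - 1.
  have : b < Num.min t 0 by rewrite ltrBlDr ltrDl.
  rewrite lt_min => /andP[bt b0].
  apply: (@near_eq_is_derive _ _ _ (fun s => I b s - I b 0)).
    near=> s; rewrite (GE b)// lt_min b0 andbT; near: s.
    exact: lt_nbhsr.
  have dc : is_derive t (1 : R) (fun=> I b 0) 0 by exact: is_derive_cst.
  by rewrite -[g t]subr0; exact: (is_deriveB (dI _ _ bt) dc).
move=> a t at_; pose b := Num.min a 0 - 1.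
have : b < Num.min a 0 by rewrite ltrBlDr ltrDl.
move=> bm; have := bm; rewrite lt_min => /andP[ba b0].
rewrite (GE b a bm) (GE b t) ?lt_min ?b0 ?(lt_le_trans ba)//.
by rewrite -/(I a t) (II b)//; ring.
Unshelve. all: by end_near. Qed.

Lemma mcont_antiderivative (m n : nat) (g : R -> 'M[C]_(m, n)) : mcont g ->
  exists2 G : R -> 'M[C]_(m, n), (forall t, has_deriv G t (g t)) &
    forall a t, a <= t -> mintegral a t g = G t - G a.
Proof.
move=> cg.
have cRe i j : continuous (fun s => complex.Re (g s i j)).
  move=> t; apply/cvgrPdist_lt => eps e0; have [d d0 hd] := cg t _ e0.
  exists d => //= s; rewrite /ball_ /= distrC => /hd; apply: le_lt_trans.
  apply: le_trans (ler_Re_normF _ i j); rewrite distrC !mxE.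
  by case: (g s i j) => ? ?; case: (g t i j) => ? ?.
have cIm i j : continuous (fun s => complex.Im (g s i j)).
  move=> t; apply/cvgrPdist_lt => eps e0; have [d d0 hd] := cg t _ e0.
  exists d => //= s; rewrite /ball_ /= distrC => /hd; apply: le_lt_trans.
  apply: le_trans (ler_Im_normF _ i j); rewrite distrC !mxE.
  by case: (g s i j) => ? ?; case: (g t i j) => ? ?.
pose Gr i j := sval (cid2 (continuous_antiderivative (cRe i j))).
pose Gi i j := sval (cid2 (continuous_antiderivative (cIm i j))).
have Gr1 i j t : is_derive t (1 : R) (Gr i j) (complex.Re (g t i j)).
  by rewrite /Gr; case: cid2 => F /= F1 F2; exact: F1.
have Gr2 i j a t : a <= t ->
    Rintegral mu `[a, t] (fun s => complex.Re (g s i j)) = Gr i j t - Gr i j a.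
  by rewrite /Gr; case: cid2 => F /= F1 F2; exact: F2.
have Gi1 i j t : is_derive t (1 : R) (Gi i j) (complex.Im (g t i j)).
  by rewrite /Gi; case: cid2 => F /= F1 F2; exact: F1.
have Gi2 i j a t : a <= t ->
    Rintegral mu `[a, t] (fun s => complex.Im (g s i j)) = Gi i j t - Gi i j a.
  by rewrite /Gi; case: cid2 => F /= F1 F2; exact: F2.
exists (fun t => \matrix_(i, j) (Gr i j t +i* Gi i j t)%C).
  move=> t; apply: has_deriv_components => i j; split.
    by under eq_fun do rewrite mxE /=; exact: Gr1.
  by under eq_fun do rewrite mxE /=; exact: Gi1.
move=> a t at_; apply/matrixP => i j; rewrite !mxE.
by rewrite Gr2// Gi2.
Qed.

End antiderivative.

(** * Almost periods *)

Section almost_periods.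
Context {R : realType}.
Local Notation C := R[i].

(* [E eps] stands for the [eps]-almost periods of some object. *)
Definition translation_family (E : R -> set R) : Prop :=
  [/\ forall eps, 0 < eps -> rel_dense (E eps),
      forall e1 e2 s t, E e1 s -> E e2 t -> E (e1 + e2) (s - t) &
      forall eps, 0 < eps -> exists2 d, 0 < d & forall s, `|s| <= d -> E eps s].

(* Every [tau] is [p + s] with [p] an almost period and [s] in a bounded interval;
   cut that interval into finitely many short cells. *)
Lemma translation_family_cells E eps : translation_family E -> 0 < eps ->
  exists (N : nat) (c : R -> 'I_N.+1), forall s t, c s = c t -> E eps (s - t).
Proof.
move=> [Ed Es Ec] e0; pose e := eps / 3; have e_gt0 : 0 < e by rewrite /e; lra.
have [l l0 hl] := Ed _ e_gt0; have [d d0 hd] := Ec _ e_gt0.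
pose p t := sval (cid2 (hl (t - l))).
have Ep t : E e (p t) by rewrite /p; case: cid2.
have pb t : 0 <= t - p t <= l.
  by rewrite /p; case: cid2 => x /= _; rewrite subrK => ?; lra.
pose N := Num.truncn (l / d).
pose k t := Num.truncn ((t - p t) / d).
have kN t : (k t < N.+1)%N.
  rewrite ltnS; apply: le_truncn; rewrite ler_pM2r ?invr_gt0//.
  by have /andP[] := pb t.
exists N, (fun t => Ordinal (kN t)) => s t [kst].
have k0 u : 0 <= (u - p u) / d.
  by rewrite divr_ge0 ?(ltW d0)//; have /andP[] := pb u.
have cell u : (k u)%:R * d <= u - p u < (k u)%:R * d + d.
  have := truncn_itv (k0 u); rewrite -/(k u) ler_pdivlMr// ltr_pdivrMr//.
  by rewrite -natr1 mulrDl mul1r.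
have := cell s; have := cell t; rewrite kst => ct cs.
have sd : `|(t - p t) - (s - p s)| <= d by rewrite ler_norml; apply/andP; split; lra.
(* [s - t] is [p s - p t] minus the difference of the two offsets, and each of these three almost
   periods costs [eps / 3]. *)
have := Es _ _ _ _ (Es _ _ _ _ (Ep s) (Ep t)) (hd _ sd).
by congr (E _ _); [rewrite /e; field|ring].
Qed.

(* Pigeonhole on pairs of cells: [t] minus the representative of its class is a
   common almost period. *)
Lemma translation_familyI E F : translation_family E -> translation_family F ->
  translation_family (fun eps => E eps `&` F eps).
Proof.
move=> hE hF; split.
- move=> eps e0.
  have [N [c hc]] := translation_family_cells hE e0.
  have [N' [c' hc']] := translation_family_cells hF e0.
  pose cl t := (c t, c' t).
  (* Pairs of cells that are never attained receive the default [0]; below, [rep] is evaluated only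
     at attained pairs, apart from the sum [M]. *)
  pose rep x := xget (0 : R) [set t | cl t = x].
  pose M := \sum_x `|rep x|.
  have M0 : 0 <= M by apply: sumr_ge0.
  exists (2 * M + 1); first lra.
  (* All representatives have absolute value at most [M], so [t - rep (cl t)] falls in
     [[m, m + 2 * M]]. *)
  move=> m; pose t := m + M.
  have cr : cl (rep (cl t)) = cl t.
    by rewrite {1}/rep; apply: (@xgetPex _ 0 [set s | cl s = cl t]); exists t.
  have [c1 c2] : c t = c (rep (cl t)) /\ c' t = c' (rep (cl t)).
    by case: cr => -> ->.
  exists (t - rep (cl t)); first by split; [exact: hc|exact: hc'].
  have : `|rep (cl t)| <= M by rewrite /M (bigD1 (cl t))//= lerDl sumr_ge0.
  by rewrite ler_norml /t => ?; lra.
- move=> e1 e2 s t [E1 F1] [E2 F2]; case: hE => _ hE _; case: hF => _ hF _.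
  by split; [exact: hE|exact: hF].
- move=> eps e0; case: hE => _ _ /(_ _ e0)[d d0 hd]; case: hF => _ _ /(_ _ e0)[d' d'0 hd'].
  exists (Num.min d d'); first by rewrite lt_min d0.
  by move=> s; rewrite le_min => /andP[s1 s2]; split; [exact: hd|exact: hd'].
Qed.

Section functions.
Context {m n : nat}.
Implicit Types g : R -> 'M[C]_(m, n).

Lemma mcont_bounded_itv g (a b : R) : mcont g -> a <= b ->
  exists M, forall t, a <= t <= b -> normF (g t) <= M.
Proof.
move=> cg ab.
have [|c _ hc] := @EVT_max R (fun t => normF (g t)) a b ab.
  by apply: continuous_subspaceT => x; exact: continuous_normF.
by exists (normF (g c)) => t tab; apply: hc; rewrite in_itv.
Qed.

(** Only [t] is confined to [[a, b]]: after a shift that carries [t] into the interval, a nearby [s]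
    may still fall outside it. *)
Lemma mcont_unif_itv g (a b : R) : mcont g -> forall eps, 0 < eps ->
  exists2 d, 0 < d & forall s t, a <= t <= b -> `|s - t| < d -> normF (g s - g t) <= eps.
Proof.
move=> cg eps e0.
have /compact_near_coveringP cK := @segment_compact R a b.
have H := cK R ((0 : R)^'+)
  (fun d t => forall s, `|s - t| < d -> normF (g s - g t) <= eps) _.
have [|d /= d0 hd] := H _.
  move=> x _; have e20 : 0 < eps / 2 by lra.
  have [d d0 hd] := cg x _ e20.
  exists (ball x (d / 2), [set e : R | e < d / 2]).
    split; first by apply: nbhsx_ballx; lra.
    by apply: nbhs_right_lt; lra.
  move=> [t e] /= [xt ed] s se.
  rewrite -(subrK (g x) (g s)) -addrA (le_trans (normFD _ _))//.
  have h1 : normF (g s - g x) < eps / 2.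
    apply: hd; rewrite -(subrK t s) -addrA; apply: le_lt_trans (ler_normD _ _) _.
    by move: xt; rewrite /ball /= distrC => xt; lra.
  have h2 : normF (g x - g t) < eps / 2.
    by rewrite normFBC; apply: hd; move: xt; rewrite /ball /= distrC => xt; lra.
  lra.
exists (d / 2); first lra.
move=> s t tab st; apply: (hd (d / 2)) => //=.
- by rewrite /ball_ /= sub0r normrN gtr0_norm; lra.
- lra.
Qed.

(** An almost period for the error [1] carries any [t] into the compact interval [[0, l]]. *)
Lemma almost_periodic_bounded g : almost_periodic g ->
  exists M, forall t, normF (g t) <= M.
Proof.
move=> [cg apg]; have [l l0 hl] := apg 1 ltr01.
have [M hM] := mcont_bounded_itv cg (ltW l0).
exists (M + 1) => t; have [tau /= ht tl] := hl (- t).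
have := ht t; rewrite normFBC => h.
rewrite -(subrK (g (t + tau)) (g t)) addrC (le_trans (normFD _ _))// lerD//.
by apply: hM; lra.
Qed.

Lemma almost_periodic_unif_cont g : almost_periodic g ->
  forall eps, 0 < eps ->
  exists2 d, 0 < d & forall s t, `|s - t| < d -> normF (g s - g t) <= eps.
Proof.
move=> [cg apg] eps e0; have e30 : 0 < eps / 3 by lra.
have [l l0 hl] := apg _ e30.
have [d d0 hd] := mcont_unif_itv 0 l cg e30.
exists d => // s t st; have [tau /= ht tl] := hl (- t).
have h1 := ht t; have h2 := ht s.
have h3 : normF (g (s + tau) - g (t + tau)) <= eps / 3.
  apply: hd; first lra.
  by rewrite (_ : _ - _ = s - t)//; ring.
have -> : g s - g t = - (g (s + tau) - g s) + (g (s + tau) - g (t + tau)) + (g (t + tau) - g t).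
  by rewrite opprB !addrA !subrK.
apply: (le_trans (normFD _ _)); rewrite [leRHS](_ : _ = eps / 3 + eps / 3 + eps / 3); last by field.
by rewrite lerD// (le_trans (normFD _ _))// normFN lerD.
Qed.

(** Differences are handled by comparing both shifts at [u - t]; that small shifts belong to the
    family is uniform continuity. *)
Lemma almost_periodic_translation_family g : almost_periodic g ->
  translation_family (fun eps => [set tau | forall t, normF (g (t + tau) - g t) <= eps]).
Proof.
move=> apg; split; first by move=> eps e0; exact: apg.2.
- move=> e1 e2 s t /= h1 h2 u; have := h1 (u - t); have := h2 (u - t).
  rewrite subrK [u - t + s]addrAC -addrA => k2 k1.
  rewrite -(subrK (g (u - t)) (g (u + (s - t)))) -addrA (le_trans (normFD _ _))//.
  by rewrite lerD// normFBC.
- move=> eps e0; have [d d0 hd] := almost_periodic_unif_cont apg e0.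
  exists (d / 2); first lra.
  move=> s sd t; apply: hd; rewrite [t + s]addrC addrK; lra.
Qed.

End functions.
End almost_periods.

(** * The switching times *)

Section sequence.
Context {R : realType} {tn : int -> R}.
Local Notation C := R[i].
Hypothesis tn_lt : forall n : int, tn n < tn (n + 1).
Hypothesis tn_pinfty : forall M : R, exists N : int, forall n : int, N <= n -> M <= tn n.
Hypothesis tn_ninfty : forall M : R, exists N : int, forall n : int, n <= N -> tn n <= M.

Lemma tn_nondecreasing (m n : int) : m <= n -> tn m <= tn n.
Proof.
move=> mn; have -> : n = m + `|n - m|%N%:Z by lia.
elim: `|n - m|%N => [|k ih]; first by rewrite addr0.
apply: (le_trans ih); rewrite (_ : m + k.+1%:Z = m + k%:Z + 1); last by lia.
exact: ltW.
Qed.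

Lemma tn_lt_index (m n : int) : tn m < tn n -> m < n.
Proof. by rewrite !ltNge; apply: contra => /tn_nondecreasing. Qed.

Lemma tn_index (t : R) : exists n : int, tn n <= t < tn (n + 1).
Proof.
have [N1 h1] := tn_ninfty t; have [N2 h2] := tn_pinfty (t + 1).
have t1 := h1 _ (lexx N1); have t2 := h2 _ (lexx N2).
have ex : exists k : nat, t < tn (N1 + k%:Z).
  have N12 : N1 < N2 by apply: tn_lt_index; lra.
  exists `|N2 - N1|%N; rewrite (_ : _ + _ = N2); last by lia.
  lra.
case: (ex_minnP ex) => -[|k] tk mk; first by move: tk; rewrite addr0; lra.
exists (N1 + k%:Z); rewrite (_ : N1 + k%:Z + 1 = N1 + k.+1%:Z); last by lia.
rewrite tk andbT leNgt; apply/negP => /mk; by rewrite ltnn.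
Qed.

Lemma tn_index_uniq (t : R) (m n : int) :
  tn m <= t < tn (m + 1) -> tn n <= t < tn (n + 1) -> m = n.
Proof.
move=> /andP[m1 m2] /andP[n1 n2].
have := tn_lt_index (le_lt_trans m1 n2); have := tn_lt_index (le_lt_trans n1 m2).
lia.
Qed.

Hypothesis tn_H2 : H2 tn.

(** By (H2) with error [1], the index [n] is moved into the finite range from [0] to [N], where all
    gaps are at most [tn (N + 1) - tn 0]. *)
Lemma tn_gap_bounded : exists th, forall n, tn (n + 1) - tn n <= th.
Proof.
have [l l0 hl] := tn_H2 ltr01.
pose N := (Num.truncn l).+1.
exists (tn (N%:Z + 1) - tn 0 + 1) => n.
have [T /= hT Tn] := hl (- (n%:~R)).
have TnN : 0 <= T + n <= N%:Z.
  have T0 : 0 <= (T + n)%:~R :> R by rewrite intrD; lra.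
  have TN : (T + n)%:~R < (N%:Z)%:~R :> R.
    apply: (@le_lt_trans _ _ l); first by rewrite intrD; lra.
    exact: truncnS_gt.
  by move: T0 TN; rewrite ler0z ltr_int => -> /ltW ->.
have := hT 1%N n; rewrite /tk ler_norml => h.
have g1 : tn (T + n + 1) <= tn (N%:Z + 1) by apply: tn_nondecreasing; lia.
have g2 : tn 0 <= tn (T + n) by apply: tn_nondecreasing; lia.
by move: h; rewrite -!/(1%Z); lra.
Qed.

(** Limits how many switching times a unit interval can hold. A block of indices from [0] spanning
    length [2] recurs, up to error [1], from some [T] between [n] and [n + L]. *)
Lemma tn_spread : exists N : nat, forall n : int, 1 <= tn (n + N%:Z) - tn n.
Proof.
have [l l0 hl] := tn_H2 ltr01.
pose L := (Num.truncn l).+1.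
have [k hk] := tn_pinfty (tn 0 + 2).
exists (L + `|k|)%N => n.
have [T /= hT Tn] := hl n%:~R.
have TnL : n <= T <= n + L%:Z.
  have T0 : n%:~R <= T%:~R :> R by lra.
  have TN : T%:~R < (n + L%:Z)%:~R :> R.
    apply: (@le_lt_trans _ _ (n%:~R + l)); first by lra.
    by rewrite intrD ltrD2l; exact: truncnS_gt.
  by move: T0 TN; rewrite ler_int ltr_int => -> /ltW ->.
have := hT `|k|%N 0; rewrite /tk ler_norml addr0 add0r => h.
have g1 : tn (T + `|k|%N%:Z) <= tn (n + (L + `|k|)%N%:Z) by apply: tn_nondecreasing; lia.
have g2 : tn n <= tn T by apply: tn_nondecreasing; lia.
have g3 : tn 0 + 2 <= tn `|k|%N%:Z by apply: hk; lia.
lra.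
Qed.

(** An integer [T] from (H2) yields the real shift [tau = tn T - tn 0]; bounded gaps transfer
    relative density from the integers to the reals. *)
Lemma tn_translation_family :
  translation_family (fun eps => [set tau : R |
    exists T : int, forall n, `|tn (n + T) - tn n - tau| <= eps]).
Proof.
split.
- move=> eps e0; have [l l0 hl] := tn_H2 e0.
  have [th hth] := tn_gap_bounded.
  pose N := (Num.truncn l).+1.
  have step (n : int) (k : nat) : tn (n + k%:Z) <= tn n + th * k%:R.
    elim: k => [|k ih]; first by rewrite addr0 mulr0 addr0.
    rewrite (_ : n + k.+1%:Z = n + k%:Z + 1); last by lia.
    by have := hth (n + k%:Z); rewrite -natr1; lra.
  have th0 : 0 < th by have := hth 0; have := tn_lt 0; lra.
  exists (th * N.+1%:R); first by rewrite mulr_gt0// ltr0n.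
  (* Looking for [T] from [n + 1] on ensures [tn T - tn 0 >= m]. *)
  move=> m; have [n hn] := tn_index (m + tn 0).
  have [T /= hT Tn] := hl (n + 1)%:~R.
  exists (tn T - tn 0).
    (* (H2) compares spans of every length [|k|]: the span from [0] to [k] or, for negative [k],
       from [k] to [0], with its translate by [T]. This is why one [T] must serve all lengths. *)
    exists T => k; have [k0|k0] := lerP 0 k.
      have := hT `|k|%N 0; rewrite /tk addr0 add0r.
      have -> : `|k|%N%:Z = k by lia.
      by rewrite [k + T]addrC; congr (_ <= _); congr `|_|; ring.
    have := hT `|k|%N k; rewrite /tk.
    have -> : T + k + `|k|%N%:Z = T by lia.
    have -> : k + `|k|%N%:Z = 0 by lia.
    rewrite [k + T]addrC -normrN; congr (_ <= _); congr `|_|; ring.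
  have TnN : n + 1 <= T <= n + N.+1%:Z.
    have T0 : (n + 1)%:~R <= T%:~R :> R by lra.
    have TN : T%:~R < (n + N.+1%:Z)%:~R :> R.
      apply: (@le_lt_trans _ _ ((n + 1)%:~R + l)); first by lra.
      rewrite (_ : n + N.+1%:Z = n + 1 + N%:Z); last by lia.
      by rewrite [ltRHS]intrD ltrD2l; exact: truncnS_gt.
    by move: T0 TN; rewrite ler_int ltr_int => -> /ltW ->.
  have g1 : tn (n + 1) <= tn T by apply: tn_nondecreasing; lia.
  have g2 : tn T <= tn (n + N.+1%:Z) by apply: tn_nondecreasing; lia.
  have g3 := step n N.+1.
  lra.
- move=> e1 e2 s t /= [S hS] [T hT]; exists (S - T) => n.
  have := hS (n - T); have := hT (n - T); rewrite subrK.
  rewrite (_ : n - T + S = n + (S - T)); last by lia.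
  rewrite !ler_norml => h1 h2; apply/andP; split; lra.
- move=> eps e0; exists eps => // s sd; exists 0 => n.
  by rewrite addr0 subrr sub0r normrN.
Qed.

Section forcing.
Context {q : nat} {f : R -> 'cV[C]_q}.
Hypothesis f_H3 : H3 tn f.

(* Closed intervals in the second half of (H3) make [f] continuous across the
   points [t_n]; a short step crosses boundedly many of them. *)
Lemma H3_unif_cont : forall eps, 0 < eps ->
  exists2 d, 0 < d & forall s t, `|s - t| < d -> normF (f s - f t) <= eps.
Proof.
move=> eps e0; have [N hN] := tn_spread.
(* A step shorter than [1] meets at most [N + 1] of the intervals, each costing [e]. *)
pose e := eps / N.+2%:R; have e_gt0 : 0 < e by rewrite divr_gt0.
have [_ [d d0 hd]] := f_H3.2 _ e_gt0.
have step (n : int) (u v : R) : tn n <= u <= tn (n + 1) -> tn n <= v <= tn (n + 1) ->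
    u <= v <= u + d -> normF (f v - f u) <= e.
  move=> hu hv uv; have := hd u (v - u); rewrite [u + _]addrC subrK; apply.
    by rewrite ger0_norm; lra.
  by exists n.
have chain (k : nat) : forall (n : int) (s t : R), tn n <= s <= tn (n + 1) ->
    tn (n + k%:Z) <= t <= tn (n + k%:Z + 1) -> s <= t <= s + d ->
    normF (f t - f s) <= e * k.+1%:R.
  elim: k => [|k ih] n s t hs ht st.
    rewrite addr0 in ht; rewrite mulr1.
    exact: (step n).
  set u := tn (n + k%:Z + 1).
  have uE : u = tn (n + k.+1%:Z) by rewrite /u; congr tn; lia.
  have su : s <= u.
    have : tn (n + 1) <= u by apply: tn_nondecreasing; lia.
    lra.
  have un : tn (n + k%:Z) <= u <= tn (n + k%:Z + 1) by rewrite lexx ltW ?tn_lt.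
  have ut : u <= t by rewrite uE; lra.
  have h1 : normF (f u - f s) <= e * k.+1%:R by apply: (ih _ _ _ hs un); lra.
  have h2 : normF (f t - f u) <= e.
    apply: (step (n + k.+1%:Z)) => //; last by lra.
    by rewrite uE lexx ltW ?tn_lt.
  rewrite -(subrK (f u) (f t)) -addrA (le_trans (normFD _ _))//.
  by rewrite -[k.+2%:R]natr1 mulrDr mulr1; lra.
have up (s t : R) : s <= t -> t < s + Num.min d 1 -> normF (f t - f s) <= eps.
  move=> st; have [n hn] := tn_index s; have [m hm] := tn_index t => ts.
  have /andP[td t1] : (t < s + d) && (t < s + 1).
    by move: ts; rewrite -ltrBlDl lt_min !ltrBlDl.
  have nm : n < m + 1 by apply: tn_lt_index; lra.
  have mn : m < n + 1 + N%:Z.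
    by apply: tn_lt_index; have := hN (n + 1); lra.
  have mE : m = n + `|m - n|%N%:Z by clear -nm; lia.
  apply: (@le_trans _ _ (e * (`|m - n|%N).+1%:R)).
    by apply: (chain _ n); rewrite -?mE; lra.
  rewrite /e mulrAC ler_pdivrMr// ler_pM2l// ler_nat; clear -nm mn; lia.
exists (Num.min d 1); first by rewrite lt_min d0 ltr01.
move=> s t st; have := ler_norm (s - t); have := ler_norm (t - s).
rewrite [X in _ <= X -> _]distrC => h1 h2.
have [le_st|lt_ts] := lerP s t; last by apply: up; lra.
by rewrite normFBC; apply: up; lra.
Qed.

(** (H3) says nothing within [eta] of a switching time. Such a [t] is replaced by a nearby [t']
    outside these neighbourhoods, at a cost of [eps / 3] at [t] and at [t + tau] by uniform
    continuity. *)
Lemma H3_almost_periodic : almost_periodic f.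
Proof.
split.
  move=> t eps e0; have e20 : 0 < eps / 2 by lra.
  have [d d0 hd] := H3_unif_cont e20.
  by exists d => [//|s st]; apply: (le_lt_trans (hd _ _ st)); lra.
move=> eps e0; have [N hN] := tn_spread.
have e30 : 0 < eps / 3 by lra.
have [d d0 hd] := H3_unif_cont e30.
pose c : R := 2 * N%:R + 2.
have c0 : 0 < c by rewrite /c; have := ler0n R N; lra.
(* The distance from [t] to [t'] is below [eta * c], hence at most [d / 2]. The bound [1/2]
   contradicts [tn_spread] if [N] consecutive gaps are all shorter than [2 * eta]. *)
pose eta := Num.min (eps / 3) (Num.min (d / 2) 2^-1 / c).
have eta0 : 0 < eta by rewrite !lt_min e30 divr_gt0// lt_min; lra.
have /andP[eta1 eta23] : (eta <= eps / 3) && (eta * c <= Num.min (d / 2) 2^-1).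
  by rewrite -ler_pdivlMr// -le_min.
move: eta23; rewrite le_min => /andP[eta2 eta3].
pose off t := forall n, ~ (tn n - eta < t < tn n + eta).
(* A run of gaps shorter than [2 * eta] has at most [N] terms, so the
   neighbourhoods of the [t_n] can be left within distance [eta * c]. *)
have escape (m : int) (k : nat) :
    (exists2 t', off t' & tn m <= t' <= tn m + 2 * eta * k%:R + eta) \/
    tn (m + k%:Z) <= tn m + 2 * eta * k%:R.
  elim: k => [|k [[t' ot' ht']|ih]]; first by right; rewrite addr0; lra.
    by left; exists t' => //; rewrite -natr1; lra.
  have [gap|gap] := lerP (tn (m + k%:Z) + 2 * eta) (tn (m + k%:Z + 1)); last first.
    by right; rewrite (_ : m + k.+1%:Z = m + k%:Z + 1); [rewrite -natr1; lra|clear; lia].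
  left; exists (tn (m + k%:Z) + eta).
    move=> n hn; have [nk|nk] := lerP n (m + k%:Z).
      by have := tn_nondecreasing nk; lra.
    have kn : m + k%:Z + 1 <= n by clear -nk; lia.
    by have := tn_nondecreasing kn; lra.
  have : tn m <= tn (m + k%:Z) by apply: tn_nondecreasing; rewrite lerDl.
  by rewrite -natr1; lra.
have near_off t : exists2 t', off t' & `|t' - t| < d.
  have [ot|] := pselect (off t); first by exists t; rewrite // subrr normr0.
  move=> /existsNP[m /contrapT hm].
  have N0 := ler0n R N; rewrite /c in eta2 eta3.
  have [[t' ot' ht']|] := escape m N; last first.
    by have := hN m; lra.
  by exists t' => //; rewrite ltr_norml; lra.
have [[l l0 hl] _] := f_H3.2 _ eta0.
exists l => // m; have [tau /= htau tl] := hl m.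
exists tau => //= t; have [t' ot' tt'] := near_off t.
have h1 := htau _ ot'.
have h2 := hd _ _ tt'.
have h3 : normF (f (t' + tau) - f (t + tau)) <= eps / 3.
  by apply: hd; rewrite (_ : _ - _ = t' - t)//; ring.
have -> : f (t + tau) - f t =
  - (f (t' + tau) - f (t + tau)) + (f (t' + tau) - f t') + (f t' - f t).
  by rewrite opprB !addrA !subrK.
apply: (le_trans (normFD _ _)).
have := normFD (- (f (t' + tau) - f (t + tau))) (f (t' + tau) - f t').
rewrite normFN; lra.
Qed.

End forcing.
End sequence.

(** * Difference equations with a dichotomy *)

Section dichotomy.
Context {R : realType} {q : nat}.
Local Notation C := R[i].

Lemma le_geometric_limit (x a b r : R) : 0 < r < 1 ->
  (forall N : nat, x <= a + b * r ^+ N) -> x <= a.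
Proof.
move=> /andP[r0 r1] H; rewrite leNgt; apply/negP => ax.
have b0 : 0 < b.
  have := H 0%N; rewrite expr0 mulr1; lra.
have e0 : 0 < (x - a) / b by rewrite divr_gt0// subr_gt0.
have cr : (fun N => r ^+ N) @ \oo --> (0 : R) by apply: cvg_expr; rewrite gtr0_norm.
have /cvgr0Pnorm_lt/(_ _ e0)[N _ hN] := cr.
have := hN N (leqnn N); rewrite /= ger0_norm ?exprn_ge0 ?(ltW r0)// ltr_pdivlMr// => h.
by have := H N; rewrite mulrC; lra.
Qed.

Lemma sum_geometric_le (r : R) (N : nat) : 0 < r < 1 ->
  \sum_(i < N) r ^+ i <= (1 - r)^-1.
Proof.
move=> /andP[r0 r1]; have r10 : 0 < 1 - r by lra.
rewrite -[leRHS]mul1r ler_pdivlMr//.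
have -> : (\sum_(i < N) r ^+ i) * (1 - r) = 1 - r ^+ N.
  elim: N => [|N ih]; first by rewrite big_ord0 mul0r expr0 subrr.
  by rewrite big_ord_recr /= mulrDl ih exprS; ring.
by rewrite lerBlDr lerDl exprn_ge0// ltW.
Qed.

Lemma real_geometric_series_cvg (a : nat -> R) (D r : R) : 0 < r < 1 ->
  (forall i, `|a i| <= D * r ^+ i) ->
  exists L : R, (fun N => \sum_(i < N) a i) @ \oo --> L.
Proof.
move=> /andP[r0 r1] ha.
have cg : cvgn (series (geometric D r)).
  by apply: is_cvg_geometric_series; rewrite gtr0_norm.
have cn : cvgn [normed series a].
  apply: series_le_cvg cg => // i; first exact: normr_ge0.
    exact: le_trans (ha i).
have := normed_cvg cn; rewrite /series /= => /cvg_ex[L hL].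
exists L; apply: cvg_trans hL; apply: near_eq_cvg; near=> N => /=.
by rewrite big_mkord.
Unshelve. all: by end_near. Qed.

Lemma geometric_series_cvg (m n : nat) (c : nat -> 'M[C]_(m, n)) (D r : R) : 0 < r < 1 ->
  (forall i, normF (c i) <= D * r ^+ i) ->
  exists L, forall eps, 0 < eps -> exists N0 : nat, forall N, (N0 <= N)%N ->
    normF (L - \sum_(i < N) c i) < eps.
Proof.
move=> r01 hc.
have hr i j : exists L : R, (fun N => \sum_(k < N) complex.Re (c k i j)) @ \oo --> L.
  apply: (@real_geometric_series_cvg (fun k => complex.Re (c k i j)) D r) => // k.
  exact: le_trans (ler_Re_normF _ _ _) (hc k).
have hi i j : exists L : R, (fun N => \sum_(k < N) complex.Im (c k i j)) @ \oo --> L.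
  apply: (@real_geometric_series_cvg (fun k => complex.Im (c k i j)) D r) => // k.
  exact: le_trans (ler_Im_normF _ _ _) (hc k).
pose lr i j := sval (cid (hr i j)); pose li i j := sval (cid (hi i j)).
have hlr i j : (fun N => \sum_(k < N) complex.Re (c k i j)) @ \oo --> lr i j.
  by rewrite /lr; case: cid.
have hli i j : (fun N => \sum_(k < N) complex.Im (c k i j)) @ \oo --> li i j.
  by rewrite /li; case: cid.
pose L := \matrix_(i, j) (lr i j +i* li i j)%C; exists L.
have sumE N i j : (\sum_(k < N) c k) i j =
    ((\sum_(k < N) complex.Re (c k i j)) +i* (\sum_(k < N) complex.Im (c k i j)))%C.
  rewrite summxE; elim: N => [|N ih]; first by rewrite !big_ord0.
  by rewrite !big_ord_recr /= ih; case: (c N i j).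
have cL : (fun N => normF (L - \sum_(i < N) c i)) @ \oo --> (0 : R).
  apply: (@squeeze_normF0 _ _ _ _ _ _ _ (fun N => \sum_i \sum_j
     (`|lr i j - \sum_(k < N) complex.Re (c k i j)| +
      `|li i j - \sum_(k < N) complex.Im (c k i j)|))).
    move=> N; apply: (le_trans (normF_le_sum _)); rewrite le_eqVlt; apply/orP; left.
    apply/eqP; apply: eq_bigr => i _; apply: eq_bigr => j _.
    by rewrite !mxE sumE.
  rewrite [X in _ --> X](_ : _ = \sum_(i < m) \sum_(j < n) (0 : R)); last first.
    by rewrite big1// => i _; rewrite big1.
  apply: (cvg_big add_continuous) => i _; apply: (cvg_big add_continuous) => j _.
  rewrite -[X in _ --> X](addr0 0); apply: cvgD; rewrite -[X in _ --> X](@normr0 _ R);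
    apply: cvg_norm.
  - rewrite -[X in _ --> X](subrr (lr i j)); apply: cvgB; [exact: cvg_cst|exact: hlr].
  - rewrite -[X in _ --> X](subrr (li i j)); apply: cvgB; [exact: cvg_cst|exact: hli].
move=> eps e0; have /cvgr0Pnorm_lt/(_ _ e0)[N0 _ hN0] := cL.
by exists N0 => N NN; have := hN0 N NN; rewrite /= ger0_norm ?normF_ge0.
Qed.

Context {H Phi : int -> 'M[C]_q} {Pi : 'M[C]_q} {K rho : R}.
Hypothesis Phi_unit : forall n, Phi n \in unitmx.
Hypothesis Phi_rec : forall n, Phi (n + 1) = H n *m Phi n.
Hypothesis K_gt0 : 0 < K.
Hypothesis rho01 : 0 < rho < 1.
Hypothesis Green_le : forall n k : int, normF (Green Phi Pi n k) <= K * rho ^+ `|n - k|%N.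

Lemma Green_lt (n k : int) : k < n -> Green Phi Pi n k = Phi n *m Pi *m invmx (Phi (k + 1)).
Proof. by rewrite /Green => ->. Qed.

Lemma Green_ge (n k : int) : n <= k ->
  Green Phi Pi n k = - (Phi n *m (1%:M - Pi) *m invmx (Phi (k + 1))).
Proof. by rewrite /Green ltNge => ->. Qed.

(** Off the diagonal the kernel follows [Phi]; at [k = n] the stable and unstable formulas differ by
    [Phi (n + 1) *m invmx (Phi (n + 1)) = 1]. This unit jump makes Green sums solve the forced
    equation. *)
Lemma Green_rec (n k : int) :
  Green Phi Pi (n + 1) k = H n *m Green Phi Pi n k + (if k == n then 1%:M else 0).
Proof.
have [kn|nk|->] := ltgtP k n.
- by rewrite !Green_lt ?Phi_rec ?addr0 ?mulmxA//; lia.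
- by rewrite !Green_ge ?Phi_rec ?addr0 ?mulmxN ?mulmxA//; lia.
- rewrite Green_lt ?Green_ge//; last by lia.
  rewrite mulmxN mulmxA mulmxA -Phi_rec mulmxBr mulmxBl mulmx1 mulmxV//.
  by rewrite opprB subrK.
Qed.

Section a_priori.
Context {p : nat} {h phi : int -> 'M[C]_(q, p)} {M eta : R}.
Hypothesis phi_rec : forall n, phi (n + 1) = H n *m phi n + h n.
Hypothesis phi_le : forall n, normF (phi n) <= M.
Hypothesis h_le : forall n, normF (h n) <= eta.

(** In these coordinates the homogeneous flow is constant, so [u] only accumulates forcing and
    telescopes. *)
Let u n := invmx (Phi n) *m phi n.

Let u_rec n : u (n + 1) = u n + invmx (Phi (n + 1)) *m h n.
Proof.
rewrite /u phi_rec mulmxDr; congr (_ + _).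
apply: (can_inj (mulKmx (Phi_unit (n + 1)))).
by rewrite mulKVmx// Phi_rec -mulmxA mulKVmx.
Qed.

(** The telescoping sum runs into the past, where the kernel with [Pi] decays; the last term is the
    remainder after [N] steps. *)
Let stable_part n (N : nat) : Phi n *m Pi *m u n =
  \sum_(j < N) Green Phi Pi n (n - 1 - j%:Z) *m h (n - 1 - j%:Z) +
  Green Phi Pi n (n - N%:Z - 1) *m phi (n - N%:Z).
Proof.
elim: N => [|N ih].
  rewrite big_ord0 add0r subr0 Green_lt; last by lia.
  by rewrite subrK /u mulmxA.
rewrite ih [in RHS]big_ord_recr /= -[RHS]addrA; congr (_ + _).
have -> : n - 1 - N%:Z = n - N.+1%:Z by lia.
have -> : n - N%:Z = n - N.+1%:Z + 1 by lia.
rewrite addrK !Green_lt; [|lia..].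
rewrite subrK [RHS]addrC.
by have := congr1 (mulmx (Phi n *m Pi)) (u_rec (n - N.+1%:Z)); rewrite /u mulmxDr !mulmxA.
Qed.

(** The same telescoping, run into the future for [1 - Pi]. *)
Let unstable_part n (N : nat) : Phi n *m (1%:M - Pi) *m u n =
  \sum_(j < N.+1) Green Phi Pi n (n + j%:Z) *m h (n + j%:Z) -
  Green Phi Pi n (n + N%:Z) *m phi (n + N%:Z + 1).
Proof.
elim: N => [|N ih].
  rewrite big_ord_recr big_ord0 /= add0r addr0 Green_ge//.
  move: (1%:M - Pi) => Q.
  have := congr1 (mulmx (Phi n *m Q)) (u_rec n); rewrite /u mulmxDr !mulmxA.
  by rewrite !mulNmx opprK => ->; rewrite [RHS]addrC addrK.
rewrite ih [in RHS]big_ord_recr /= -[RHS]addrA; congr (_ + _).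
have -> : n + N%:Z + 1 = n + N.+1%:Z by lia.
rewrite !Green_ge; [|lia..].
have -> : n + N%:Z + 1 = n + N.+1%:Z by lia.
move: (1%:M - Pi) => Q.
have := congr1 (mulmx (Phi n *m Q)) (u_rec (n + N.+1%:Z)).
rewrite /u mulmxDr !mulmxA !mulNmx !opprK => ->.
by rewrite [RHS]addrC addrK.
Qed.

(** Each of the two parts contributes a geometric sum, whence the factor [2]. The remainders are at
    most [K * M * rho ^+ N] and vanish as [N] grows, so [M] does not enter the bound. *)
Lemma bounded_solution_le n : normF (phi n) <= 2 * K / (1 - rho) * eta.
Proof.
have [r0 r1] := andP rho01.
have M0 : 0 <= M := le_trans (normF_ge0 _) (phi_le 0).
have eta0 : 0 <= eta := le_trans (normF_ge0 _) (h_le 0).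
apply: (@le_geometric_limit _ _ (2 * K * M) rho) => // N.
have phiE : phi n = Phi n *m Pi *m u n + Phi n *m (1%:M - Pi) *m u n.
  by rewrite -mulmxDl -mulmxDr addrC subrK mulmx1 /u mulKVmx.
have GM n' k x : normF (x : 'M[C]_(q, p)) <= M ->
    normF (Green Phi Pi n' k *m x) <= K * rho ^+ `|n' - k|%N * M.
  by move=> xM; rewrite (le_trans (normFM _ _))// ler_pM ?normF_ge0.
have Gh n' k : normF (Green Phi Pi n' k *m h k) <= K * rho ^+ `|n' - k|%N * eta.
  by rewrite (le_trans (normFM _ _))// ler_pM ?normF_ge0.
have geo (N' : nat) : \sum_(j < N') K * rho ^+ j * eta <= K / (1 - rho) * eta.
  rewrite -mulr_suml -mulr_sumr ler_wpM2r// ler_pM2l//.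
  exact: sum_geometric_le.
have S1 : normF (Phi n *m Pi *m u n) <= K / (1 - rho) * eta + K * M * rho ^+ N.
  rewrite (stable_part n N) (le_trans (normFD _ _))//; apply: lerD.
    apply: (le_trans (normF_sum _ _ _)); apply: le_trans (geo N).
    apply: ler_sum => j _; apply: (le_trans (Gh _ _)); rewrite ler_wpM2r// ler_pM2l//.
    rewrite (_ : `|_|%N = j.+1); last by clear; lia.
    by rewrite exprS ler_piMl ?exprn_ge0 ?ltW.
  apply: (le_trans (GM _ _ _ (phi_le _))); rewrite mulrAC ler_wpM2l ?mulr_ge0 ?(ltW K_gt0)//.
  rewrite (_ : `|_|%N = N.+1); last by clear; lia.
  by rewrite exprS ler_piMl ?exprn_ge0 ?ltW.
have S2 : normF (Phi n *m (1%:M - Pi) *m u n) <= K / (1 - rho) * eta + K * M * rho ^+ N.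
  rewrite (unstable_part n N) (le_trans (normFB _ _))//; apply: lerD.
    apply: (le_trans (normF_sum _ _ _)); apply: le_trans (geo N.+1).
    apply: ler_sum => j _; apply: (le_trans (Gh _ _)).
    by rewrite (_ : `|_|%N = j)//; clear; lia.
  apply: (le_trans (GM _ _ _ (phi_le _))); rewrite mulrAC ler_wpM2l ?mulr_ge0 ?(ltW K_gt0)//.
  by rewrite (_ : `|_|%N = N)//; clear; lia.
rewrite phiE (le_trans (normFD _ _))// (le_trans (lerD S1 S2))//.
by rewrite le_eqVlt; apply/orP; left; apply/eqP; ring.
Qed.

End a_priori.

(** The solution is the two-sided Green series. Its partial sums solve the equation with [h] cut off
    outside [[-N, N)], so the a priori estimate bounds them uniformly and the limit inherits the
    bound. *)
Lemma bounded_solution_exists (p : nat) (h : int -> 'M[C]_(q, p)) (eta : R) :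
  (forall n, normF (h n) <= eta) ->
  exists2 phi : int -> 'M[C]_(q, p), (forall n, phi (n + 1) = H n *m phi n + h n) &
    forall n, normF (phi n) <= 2 * K / (1 - rho) * eta.
Proof.
move=> h_le; have [r0 r1] := andP rho01.
have eta0 : 0 <= eta := le_trans (normF_ge0 _) (h_le 0).
(* Pairing the indices [i] and [-i - 1] lists every integer once and makes the series one-sided. *)
pose c (n : int) (i : nat) := Green Phi Pi n i%:Z *m h i%:Z +
  Green Phi Pi n (- i%:Z - 1) *m h (- i%:Z - 1).
pose S n N := \sum_(i < N) c n i.
have S0 n : S n 0%N = 0 by rewrite /S big_ord0.
have SS n N : S n N.+1 = S n N + c n N by rewrite /S big_ord_recr.
have Gh n k : normF (Green Phi Pi n k *m h k) <= K * rho ^+ `|n - k|%N * eta.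
  by rewrite (le_trans (normFM _ _))// ler_pM ?normF_ge0.
have S_rec N n : S (n + 1) N = H n *m S n N +
    (if (- N%:Z <= n) && (n < N%:Z) then h n else 0).
  elim: N => [|N ih].
    have -> : (- 0%N%:Z <= n) && (n < 0%N%:Z) = false by clear; lia.
    by rewrite !S0 mulmx0 addr0.
  rewrite !SS ih mulmxDr; move: (S n N) => s {S0 SS ih}.
  rewrite /c !Green_rec mulmxDr !mulmxDl !mulmxA.
  set X := H n *m _ *m _; set Y := H n *m _ *m _.
  have [nE|nN] := eqVneq N%:Z n.
    rewrite nE (_ : (- n - 1 == n) = false); last by clear -nE; lia.
    rewrite (_ : (- n <= n) && (n < n) = false); last by clear -nE; lia.
    rewrite (_ : (- N.+1%:Z <= n) && (n < N.+1%:Z) = true); last by clear -nE; lia.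
    by rewrite mul1mx mul0mx; apply/matrixP => i j; rewrite !mxE; ring.
  have [nE'|nN'] := eqVneq (- N%:Z - 1) n.
    rewrite (_ : (- N%:Z <= n) && (n < N%:Z) = false); last by clear -nE'; lia.
    rewrite (_ : (- N.+1%:Z <= n) && (n < N.+1%:Z) = true); last by clear -nE'; lia.
    by rewrite mul1mx mul0mx -nE'; apply/matrixP => i j; rewrite !mxE; ring.
  rewrite (_ : (- N.+1%:Z <= n) && (n < N.+1%:Z) =
               (- N%:Z <= n) && (n < N%:Z)); last by clear -nN nN'; lia.
  by rewrite !mul0mx; apply/matrixP => i j; rewrite !mxE; ring.
have S_le n N : normF (S n N) <= 2 * K / (1 - rho) * eta.
  pose hN (n : int) := if (- N%:Z <= n) && (n < N%:Z) then h n else 0.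
  (* The crude bound [2 * K * eta] per term depends on [N], but the a priori estimate requires only
     some bound. *)
  apply: (@bounded_solution_le p hN (fun n => S n N) (\sum_(i < N) (2 * K * eta))).
  - by move=> k; exact: S_rec.
  - move=> k; apply: (le_trans (normF_sum _ _ _)); apply: ler_sum => i _.
    apply: (le_trans (normFD _ _)).
    have le1 l : K * rho ^+ l * eta <= K * eta.
      by rewrite ler_wpM2r// -[leRHS]mulr1 ler_pM2l// exprn_ile1 ?ltW.
    have h1 := le_trans (Gh k i%:Z) (le1 _).
    have h2 := le_trans (Gh k (- i%:Z - 1)) (le1 _).
    lra.
  - by move=> k; rewrite /hN; case: ifP => _; rewrite ?h_le// normF0.
(* For [|k| >= i] one has [|n - k| + |n| >= i]; the factor [rho ^- |n|] is the price of a rate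
   independent of [n]. *)
have c_le n i : normF (c n i) <= (2 * K * eta / rho ^+ `|n|%N) * rho ^+ i.
  have dec (k : int) : (i <= `|k|)%N ->
      K * rho ^+ `|n - k|%N * eta <= K * eta / rho ^+ `|n|%N * rho ^+ i.
    move=> ik; rewrite [leRHS]mulrAC ler_pdivlMr ?exprn_gt0//.
    have E (x y : R) : K * x * eta * y = K * eta * (x * y) by ring.
    rewrite E ler_wpM2l ?mulr_ge0 ?(ltW K_gt0)//.
    rewrite -exprD; apply: ler_wiXn2l; [exact: ltW|exact: ltW|clear -ik; lia].
  apply: (le_trans (normFD _ _)).
  have h1 := le_trans (Gh n i%:Z) (dec i%:Z _).
  have h2 := le_trans (Gh n (- i%:Z - 1)) (dec (- i%:Z - 1) _).
  apply: (le_trans (lerD (h1 _) (h2 _))); [clear; lia..|].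
  by rewrite le_eqVlt; apply/orP; left; apply/eqP; ring.
pose phi n := sval (cid (geometric_series_cvg rho01 (c_le n))).
have phiP n : forall eps, 0 < eps -> exists N0 : nat, forall N, (N0 <= N)%N ->
    normF (phi n - S n N) < eps.
  by rewrite /phi; case: cid.
exists phi.
  move=> n; apply/eqP; rewrite -subr_eq0; apply/eqP/normF_le0.
  apply/ler_addgt0Pr => eps e0; rewrite add0r.
  pose b := 1 + normF (H n); have b0 : 0 < b by rewrite ltr_pwDl ?normF_ge0.
  have eb : 0 < eps / b by rewrite divr_gt0.
  have [N1 h1] := phiP n _ eb; have [N2 h2] := phiP (n + 1) _ eb.
  pose N := (maxn (maxn N1 N2) `|n|.+1)%N.
  have {}h1 : normF (phi n - S n N) < eps / b by apply: h1; rewrite /N; clear; lia.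
  have {}h2 : normF (phi (n + 1) - S (n + 1) N) < eps / b by apply: h2; rewrite /N; clear; lia.
  have SN : S (n + 1) N = H n *m S n N + h n.
    by rewrite S_rec ifT//; rewrite /N; clear; lia.
  have -> : phi (n + 1) - (H n *m phi n + h n) =
      (phi (n + 1) - S (n + 1) N) - H n *m (phi n - S n N).
    rewrite SN mulmxBr; apply/matrixP => i j; rewrite !mxE; ring.
  apply: (le_trans (normFB _ _)).
  apply: (@le_trans _ _ (eps / b + normF (H n) * (eps / b))).
    apply: lerD; first exact: ltW.
    exact: le_trans (normFM _ _) (ler_wpM2l (normF_ge0 (H n)) (ltW h1)).
  rewrite -{1}(mul1r (eps / b)) -mulrDl -/b mulrCA divff ?mulr1//.
  by rewrite gt_eqF.
move=> n; apply/ler_addgt0Pr => eps e0; have [N0 hN0] := phiP n _ e0.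
have := hN0 N0 (leqnn N0) => /ltW hN.
rewrite -(subrK (S n N0) (phi n)) addrC (le_trans (normFD _ _))// lerD//.
Qed.

End dichotomy.

(** * Linear differential equations *)

Section linear_equation.
Context {R : realType} {q : nat}.
Local Notation C := R[i].
Context {A X : R -> 'M[C]_q} {al th : R}.
Hypothesis X_unit : forall t, X t \in unitmx.
Hypothesis dX : forall t, has_deriv X t (A t *m X t).
Hypothesis A_le : forall t, normF (A t) <= al.
Hypothesis th_ge0 : 0 <= th.

Let al_ge0 : 0 <= al. Proof. exact: le_trans (normF_ge0 _) (A_le 0). Qed.

(** The integrand contains [Xts X a u], so the last clause has the shape of [Zn]. The function [w]
    itself is built on a global antiderivative and solves the equation on both sides of [a]. *)
Lemma variation_of_constants (p : nat) (g : R -> 'M[C]_(q, p)) (a : R) (c : 'M[C]_(q, p)) :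
  mcont g -> exists w : R -> 'M[C]_(q, p),
    [/\ forall t, has_deriv w t (A t *m w t + g t), w a = c &
        forall t, a <= t -> w t = X t *m (invmx (X a) *m
          (c + mintegral a t (fun u => X a *m invmx (X u) *m g u)))].
Proof.
move=> cg.
have cX : mcont X := has_deriv_mcont dX.
have cG : mcont (fun u => X a *m invmx (X u) *m g u).
  by apply: mcontM => //; apply: mcontM; [exact: mcont_cst|exact: mcont_invmx].
have [G dG GE] := mcont_antiderivative cG.
exists (fun t => X t *m (invmx (X a) *m (c + (G t - G a)))); split.
- move=> t.
  have d1 := has_derivD (has_deriv_cst c t) (has_derivB (dG t) (has_deriv_cst (G a) t)).
  have d2 := has_derivM (dX t) (has_derivM (has_deriv_cst (invmx (X a)) t) d1).
  rewrite add0r mul0mx add0r subr0 in d2.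
  rewrite (_ : X t *m (invmx (X a) *m (X a *m invmx (X t) *m g t)) = g t) in d2.
    by rewrite mulmxA.
  by rewrite -!mulmxA mulKmx// mulmxA mulmxV// mul1mx.
- by rewrite subrr addr0 mulKVmx.
- by move=> t at_; rewrite GE.
Qed.

Lemma linear_solution_le (p : nat) (w r : R -> 'M[C]_(q, p)) (a b rh : R) :
  mcont w -> b - a <= th -> 0 <= rh ->
  (forall t, a < t < b -> has_deriv w t (A t *m w t + r t)) ->
  (forall t, a < t < b -> normF (r t) <= rh) ->
  forall t, a <= t <= b -> normF (w t) <= expR (al * th) * (normF (w a) + rh * th).
Proof.
move=> cw ba rh0 dw rle t tab.
have vle s : a < s < b -> normF (A s *m w s + r s) <= al * normF (w s) + rh.
  move=> sab; apply: (le_trans (normFD _ _)); apply: lerD; last exact: rle.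
  by apply: (le_trans (normFM _ _)); apply: ler_wpM2r; [exact: normF_ge0|exact: A_le].
apply: (le_trans (gronwall cw al_ge0 rh0 dw vle tab)).
have tath : t - a <= th by lra.
have ta0 : 0 <= t - a by lra.
apply: ler_pM.
- exact: expR_ge0.
- by apply: addr_ge0; [exact: normF_ge0|exact: mulr_ge0].
- by rewrite ler_expR; apply: ler_wpM2l.
- by rewrite lerD2l; apply: ler_wpM2l.
Qed.

(** Gronwall's inequality with growth rate [0], applied to [w - w s]. *)
Lemma mean_value_le (p : nat) (w v : R -> 'M[C]_(q, p)) (a b L : R) :
  mcont w -> 0 <= L ->
  (forall t, a < t < b -> has_deriv w t (v t)) ->
  (forall t, a < t < b -> normF (v t) <= L) ->
  forall s t, a <= s -> s <= t -> t <= b -> normF (w t - w s) <= L * (t - s).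
Proof.
move=> cw L0 dw vL s t as_ st tb.
have dws u : s < u < t -> has_deriv (fun u => w u - w s) u (v u).
  move=> ust; rewrite -[v u]subr0; apply: has_derivB; last exact: has_deriv_cst.
  by apply: dw; lra.
have vLs u : s < u < t -> normF (v u) <= 0 * normF (w u - w s) + L.
  by move=> ust; rewrite mul0r add0r; apply: vL; lra.
have stt : s <= t <= t by rewrite st lexx.
have := gronwall (mcontB cw (mcont_cst (w s))) (lexx 0) L0 dws vLs stt.
by rewrite mul0r expR0 mul1r subrr normF0 add0r.
Qed.

(* Near the ends of [a, b] only the Lipschitz bound is available. *)
Lemma linear_solution_collar_le (p : nat) (w r : R -> 'M[C]_(q, p)) (a b e D rh : R) :
  mcont w -> w a = 0 -> b - a <= th -> 0 < e -> 0 <= D -> 0 <= rh ->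
  (forall s t, a <= s -> s <= t -> t <= b -> normF (w t - w s) <= D * (t - s)) ->
  (forall t, a + e < t < b - e -> has_deriv w t (A t *m w t + r t)) ->
  (forall t, a + e < t < b - e -> normF (r t) <= rh) ->
  forall t, a <= t <= b ->
    normF (w t) <= expR (al * th) * (D * e + rh * th) + D * e.
Proof.
move=> cw wa ba e0 D0 rh0 lip dw rle t /andP[at_ tb].
set K0 := expR _.
have K01 : 1 <= K0 by rewrite /K0 -expR0 ler_expR mulr_ge0.
have De : 0 <= D * e by apply: mulr_ge0 => //; exact: ltW.
have rt : 0 <= rh * th by apply: mulr_ge0.
have KDe : D * e + rh * th <= K0 * (D * e + rh * th).
  by rewrite -[leLHS]mul1r; apply: ler_wpM2r => //; exact: addr_ge0.
have near_a s : a <= s <= b -> normF (w s) <= D * (s - a).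
  by move=> /andP[as_ sb]; have := lip a s (lexx a) as_ sb; rewrite wa subr0.
have [tae|aet] := lerP t (a + e).
  have : D * (t - a) <= D * e by apply: ler_wpM2l => //; lra.
  by have := near_a t; rewrite at_ tb => /(_ isT); lra.
have mid s : a + e <= s <= b - e -> normF (w s) <= K0 * (D * e + rh * th).
  move=> sab.
  have ba' : b - e - (a + e) <= th by lra.
  apply: (le_trans (linear_solution_le cw ba' rh0 dw rle sab)).
  apply: ler_wpM2l; first exact: expR_ge0.
  rewrite lerD2r; have := near_a (a + e).
  by rewrite (_ : a + e - a = e); [apply; lra|ring].
have [tbe|bet] := lerP t (b - e); first by have := mid t; lra.
have [abe|bae] := lerP (a + e) (b - e).
  have h1 := mid (b - e); have h2 : normF (w t - w (b - e)) <= D * (t - (b - e)).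
    by apply: lip => //; lra.
  have : D * (t - (b - e)) <= D * e by apply: ler_wpM2l => //; lra.
  rewrite -(subrK (w (b - e)) (w t)) => h3.
  apply: (le_trans (normFD _ _)); rewrite addrC; apply: lerD; last exact: le_trans h3.
  by apply: h1; lra.
(* Here the two collars overlap, so [t] is within [2 * e] of [a]; since [K0 >= 1], the claimed bound
   already contains [2 * D * e]. *)
have : D * (t - a) <= D * (2 * e) by apply: ler_wpM2l => //; lra.
by have := near_a t; rewrite at_ tb => /(_ isT); lra.
Qed.

End linear_equation.

(** * Gluing across the switching times *)

Section gluing.
Context {R : realType}.
Local Notation C := R[i].
Context {m n : nat}.
Implicit Types f g y : R -> 'M[C]_(m, n).

Lemma has_rderiv_near f g (a b : R) u : a < b ->
  (forall s, a <= s <= b -> f s = g s) -> has_deriv f a u -> has_rderiv g a u.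
Proof.
move=> ab fg /has_deriv_rderiv hf eps e0; have [d d0 hd] := hf _ e0.
exists (Num.min d (b - a)); first by rewrite lt_min d0 subr_gt0.
move=> h; rewrite lt_min => /andP[h0 /andP[hd1 hb]].
rewrite -!fg; [|lra..].
by apply: hd; rewrite h0.
Qed.

Lemma has_lderiv_near f g (a b : R) u : a < b ->
  (forall s, a <= s <= b -> f s = g s) -> has_deriv f b u -> has_lderiv g b u.
Proof.
move=> ab fg /has_deriv_lderiv hf eps e0; have [d d0 hd] := hf _ e0.
exists (Num.min d (b - a)); first by rewrite lt_min d0 subr_gt0.
move=> h /andP[hh h0].
have [hd1 hb] : - d < h /\ a - b < h.
  move: hh; rewrite ltrNl lt_min => /andP[]; lra.
rewrite -!fg; [|lra..].
by apply: hd; rewrite h0 hd1.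
Qed.

(** The intervals are closed, so at [tn k] both adjacent pieces equal [y]: this is the matching
    condition that gives continuity there. *)
Lemma mcont_glue y (Y : int -> R -> 'M[C]_(m, n)) (tn : int -> R) :
  (forall k, tn k < tn (k + 1)) ->
  (forall t, exists k, tn k <= t < tn (k + 1)) ->
  (forall k, mcont (Y k)) ->
  (forall k t, tn k <= t <= tn (k + 1) -> y t = Y k t) -> mcont y.
Proof.
move=> tn_lt idx cY yY t eps e0.
have [k /andP[kt tk]] := idx t.
have [d1 d10 hd1] := cY k t _ e0.
move: kt; rewrite le_eqVlt => /predU1P[tE|kt]; last first.
  exists (Num.min d1 (Num.min (t - tn k) (tn (k + 1) - t))).
    by rewrite !lt_min d10; lra.
  move=> s; rewrite !lt_min => /and3P[s1 s2 s3].
  have := ler_norm (s - t); have := ler_norm (t - s); rewrite [`|t - s|]distrC => h1 h2.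
  rewrite (yY k s); last by lra.
  rewrite (yY k t); last by lra.
  exact: hd1.
have k1 : k - 1 + 1 = k by rewrite subrK.
have lt1 := tn_lt (k - 1); rewrite k1 in lt1.
have [d2 d20 hd2] := cY (k - 1) t _ e0.
exists (Num.min (Num.min d1 d2) (Num.min (t - tn (k - 1)) (tn (k + 1) - t))).
  by rewrite !lt_min d10 d20; lra.
move=> s; rewrite !lt_min => /andP[/andP[s1 s2] /andP[s3 s4]].
have := ler_norm (s - t); have := ler_norm (t - s); rewrite [`|t - s|]distrC => h1 h2.
have [ts|st] := lerP t s.
  rewrite (yY k s); last by lra.
  rewrite (yY k t); last by lra.
  exact: hd1.
rewrite (yY (k - 1) s); last by rewrite k1; lra.
rewrite (yY (k - 1) t); last by rewrite k1; lra.
exact: hd2.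
Qed.

End gluing.

(** * The equation with piecewise constant argument *)

Section piecewise.
Context {R : realType} {q : nat}.
Local Notation C := R[i].
Context {tn : int -> R} {A B X : R -> 'M[C]_q} {f : R -> 'cV[C]_q} {Phi : int -> 'M[C]_q}
  {Pi : 'M[C]_q} {K rho al be ph th : R}.
Hypothesis tn_lt : forall n : int, tn n < tn (n + 1).
Hypothesis tn_pinfty : forall M : R, exists N : int, forall n : int, N <= n -> M <= tn n.
Hypothesis tn_ninfty : forall M : R, exists N : int, forall n : int, n <= N -> tn n <= M.
Hypothesis X_unit : forall t, X t \in unitmx.
Hypothesis dX : forall t, has_deriv X t (A t *m X t).
Hypothesis Phi_unit : forall n, Phi n \in unitmx.
Hypothesis Phi_rec : forall n, Phi (n + 1) = Hn tn X B n *m Phi n.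
Hypothesis apA : almost_periodic A.
Hypothesis apB : almost_periodic B.
Hypothesis f_H3 : H3 tn f.
Hypothesis K_gt0 : 0 < K.
Hypothesis rho01 : 0 < rho < 1.
Hypothesis Green_le : forall n k : int, normF (Green Phi Pi n k) <= K * rho ^+ `|n - k|%N.
Hypothesis A_le : forall t, normF (A t) <= al.
Hypothesis B_le : forall t, normF (B t) <= be.
Hypothesis f_le : forall t, normF (f t) <= ph.
Hypothesis gap_le : forall n, tn (n + 1) - tn n <= th.

Let K0 : R := expR (al * th).
Let al_ge0 : 0 <= al. Proof. exact: le_trans (normF_ge0 _) (A_le 0). Qed.
Let be_ge0 : 0 <= be. Proof. exact: le_trans (normF_ge0 _) (B_le 0). Qed.
Let ph_ge0 : 0 <= ph. Proof. exact: le_trans (normF_ge0 _) (f_le 0). Qed.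
Let th_ge0 : 0 <= th.
Proof. by have := gap_le 0; have := tn_lt 0; lra. Qed.
Let K0_ge0 : 0 <= K0. Proof. exact: expR_ge0. Qed.

Let apf : almost_periodic f.
Proof. exact: (H3_almost_periodic tn_lt tn_pinfty tn_ninfty f_H3.1 f_H3). Qed.

(* [Zn] is given by an integral over [t_n, t], hence is only meaningful for
   [t_n <= t]; [Zx n] solves the same equation on the whole line. *)
Lemma Zn_extension : exists Zx : int -> R -> 'M[C]_q,
  [/\ forall n t, has_deriv (Zx n) t (A t *m Zx n t + B t),
      forall n, Zx n (tn n) = 1%:M &
      forall n, Hn tn X B n = Zx n (tn (n + 1))].
Proof.
have H n := variation_of_constants X_unit dX (tn n) 1%:M apB.1.
exists (fun n => sval (cid (H n))); split=> n; case: cid => Z [/= Z1 Z2 Z3] //.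
by rewrite Z3 ?(ltW (tn_lt n))// /Hn /Zn /Xts /Jn mulmxA.
Qed.

Lemma forced_extension : exists F : int -> R -> 'cV[C]_q,
  (forall n t, has_deriv (F n) t (A t *m F n t + f t)) /\ (forall n, F n (tn n) = 0).
Proof.
have H n := variation_of_constants X_unit dX (tn n) 0 apf.1.
by exists (fun n => sval (cid (H n))); split=> n; case: cid => F [/= F1 F2 _].
Qed.

Context {Z : int -> R -> 'M[C]_q} {F : int -> R -> 'cV[C]_q}.
Hypothesis dZ : forall n t, has_deriv (Z n) t (A t *m Z n t + B t).
Hypothesis Z1 : forall n, Z n (tn n) = 1%:M.
Hypothesis HZ : forall n, Hn tn X B n = Z n (tn (n + 1)).
Hypothesis dF : forall n t, has_deriv (F n) t (A t *m F n t + f t).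
Hypothesis F0 : forall n, F n (tn n) = 0.

Let dZv n (v : 'cV[C]_q) t :
  has_deriv (fun s => Z n s *m v) t (A t *m (Z n t *m v) + B t *m v).
Proof.
have := has_derivM (dZ n t) (has_deriv_cst v t).
by rewrite mulmx0 addr0 mulmxDl mulmxA.
Qed.

Let cZv n (v : 'cV[C]_q) : mcont (fun s => Z n s *m v).
Proof. exact: has_deriv_mcont (dZv n v). Qed.

Let cF n : mcont (F n).
Proof. exact: has_deriv_mcont (dF n). Qed.

(** Gronwall's bound for [Z n t *m v], which starts at [v] and is forced by [B t *m v]. *)
Let cZ : R := K0 * (1 + be * th).

Let cZ_ge0 : 0 <= cZ.
Proof. by rewrite mulr_ge0// addr_ge0// mulr_ge0. Qed.

Let Zv_le n (v : 'cV[C]_q) t : tn n <= t <= tn (n + 1) ->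
  normF (Z n t *m v) <= cZ * normF v.
Proof.
move=> tnt.
have Bv s : tn n < s < tn (n + 1) -> normF (B s *m v) <= be * normF v.
  by move=> _; apply: (le_trans (normFM _ _)); apply: ler_wpM2r (B_le s); exact: normF_ge0.
have r0 : 0 <= be * normF v by apply: mulr_ge0 => //; exact: normF_ge0.
have := linear_solution_le A_le (cZv n v) (gap_le n) r0 (fun s _ => dZv n v s) Bv tnt.
rewrite Z1 mul1mx => h; apply: (le_trans h); rewrite -/K0 /cZ.
by rewrite le_eqVlt; apply/orP; left; apply/eqP; ring.
Qed.

Let F_le n t : tn n <= t <= tn (n + 1) -> normF (F n t) <= K0 * (ph * th).
Proof.
move=> tnt.
have := linear_solution_le A_le (cF n) (gap_le n) ph_ge0
  (fun s _ => dF n s) (fun s _ => f_le s) tnt.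
by rewrite F0 normF0 add0r.
Qed.

Let c3 : R := cZ * (2 * K / (1 - rho)) + 1.

(** The difference of the two sides vanishes at [tn n] and satisfies the homogeneous equation, so
    Gronwall's inequality makes it zero. *)
Lemma solution_pieces y : is_solution tn A B f y ->
  forall n t, tn n <= t <= tn (n + 1) -> y t = Z n t *m y (tn n) + F n t.
Proof.
move=> [cy [dy _]] n t tnt.
set v := y (tn n).
pose d s := y s - (Z n s *m v + F n s).
have cd : mcont d by apply: mcontB => //; exact: mcontD.
have dd s : tn n < s < tn (n + 1) -> has_deriv d s (A s *m d s + 0).
  move=> sn; have := has_derivB (dy n s sn) (has_derivD (dZv n v s) (dF n s)).
  congr (has_deriv _ _ _); rewrite /d -/v addr0 mulmxBr mulmxDr.
  by apply/matrixP => i j; rewrite !mxE; ring.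
have r0 s : tn n < s < tn (n + 1) -> normF (0 : 'cV[C]_q) <= 0 by rewrite normF0.
have := linear_solution_le A_le cd (gap_le n) (lexx 0) dd r0 tnt.
rewrite {2}/d Z1 F0 mul1mx addr0 subrr normF0 mul0r addr0 mulr0 => /normF_le0 /eqP.
by rewrite subr_eq0 => /eqP.
Qed.

(** At the switching times the difference is a bounded solution with zero forcing, so the dichotomy
    estimate annihilates it; the piece formula extends this to all [t]. *)
Lemma bounded_solution_unique y z : is_solution tn A B f y -> is_solution tn A B f z ->
  (exists M, forall t, normF (y t) <= M) -> (exists M, forall t, normF (z t) <= M) ->
  z = y.
Proof.
move=> sy sz [M1 hM1] [M2 hM2].
have py := solution_pieces sy; have pz := solution_pieces sz.
pose w n := z (tn n) - y (tn n).
have wrec n : w (n + 1) = Hn tn X B n *m w n + 0.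
  have tt : tn n <= tn (n + 1) <= tn (n + 1) by rewrite lexx andbT ltW.
  rewrite /w (py n _ tt) (pz n _ tt) HZ mulmxBr addr0.
  by apply/matrixP => i j; rewrite !mxE; ring.
have wle n : normF (w n) <= M2 + M1.
  by apply: (le_trans (normFB _ _)); exact: lerD.
have h0 (n : int) : normF (0 : 'cV[C]_q) <= 0 by rewrite normF0.
have w0 n : w n = 0.
  apply: normF_le0; have := bounded_solution_le Phi_unit Phi_rec K_gt0 rho01 Green_le wrec wle h0 n.
  by rewrite mulr0.
apply/funext => t; have [n /andP[nt tn1]] := tn_index tn_lt tn_pinfty tn_ninfty t.
have tt : tn n <= t <= tn (n + 1) by rewrite nt ltW.
rewrite (py n _ tt) (pz n _ tt); have /eqP := w0 n.
by rewrite subr_eq0 => /eqP ->.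
Qed.

Lemma bounded_solution_construction : exists2 y, is_solution tn A B f y &
  forall t, normF (y t) <= c3 * (K0 * (ph * th)).
Proof.
pose h n := F n (tn (n + 1)).
have hle n : normF (h n) <= K0 * (ph * th).
  by apply: F_le; rewrite lexx andbT ltW.
have [phi phirec phile] :=
  bounded_solution_exists Phi_unit Phi_rec K_gt0 rho01 Green_le hle.
pose Y n t := Z n t *m phi n + F n t.
have idx := tn_index tn_lt tn_pinfty tn_ninfty.
pose ix t := sval (cid (idx t)).
have ixP t : tn (ix t) <= t < tn (ix t + 1) by rewrite /ix; case: cid.
pose y t := Y (ix t) t.
have Yn n : Y n (tn n) = phi n by rewrite /Y Z1 F0 mul1mx addr0.
have Yn1 n : Y n (tn (n + 1)) = phi (n + 1) by rewrite /Y phirec HZ.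
have yY n t : tn n <= t <= tn (n + 1) -> y t = Y n t.
  (* At the right endpoint [y] is defined by the next piece; the recursion for [phi] says precisely
     that the two pieces agree there. *)
  move=> /andP[nt]; rewrite le_eqVlt => /predU1P[->|tn1].
    have lt2 := tn_lt (n + 1).
    have hn : tn (n + 1) <= tn (n + 1) < tn (n + 1 + 1) by rewrite lexx.
    by rewrite /y (tn_index_uniq tn_lt (ixP _) hn) Yn Yn1.
  have hn : tn n <= t < tn (n + 1) by rewrite nt.
  by rewrite /y (tn_index_uniq tn_lt (ixP _) hn).
have dY n t : has_deriv (Y n) t (A t *m Y n t + B t *m phi n + f t).
  have := has_derivD (dZv n (phi n) t) (dF n t).
  congr (has_deriv _ _ _); rewrite /Y mulmxDr.
  by rewrite -!addrA; congr (_ + _); rewrite addrCA.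
have ytn n : y (tn n) = phi n by rewrite (yY n) ?Yn// lexx ltW.
exists y.
  split; last split.
  - exact: (mcont_glue tn_lt idx (fun n => has_deriv_mcont (dY n)) yY).
  - move=> n t tnt.
    have tnt' : tn n <= t <= tn (n + 1) by lra.
    rewrite ytn (yY n t tnt').
    apply: (has_deriv_near tnt _ (dY n t)) => s sn.
    by rewrite (yY n)//; lra.
  - move=> n; split.
      have n1 : n - 1 + 1 = n by rewrite subrK.
      have lt1 := tn_lt (n - 1); rewrite n1 in lt1.
      exists (A (tn n) *m Y (n - 1) (tn n) + B (tn n) *m phi (n - 1) + f (tn n)).
      apply: (has_lderiv_near lt1 _ (dY (n - 1) (tn n))) => s sn.
      by rewrite (yY (n - 1))// n1.
    exists (A (tn n) *m Y n (tn n) + B (tn n) *m phi n + f (tn n)).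
    apply: (has_rderiv_near (tn_lt n) _ (dY n (tn n))) => s sn.
    by rewrite (yY n).
move=> t; have tt : tn (ix t) <= t <= tn (ix t + 1).
  by have := ixP t; lra.
rewrite (yY _ _ tt) /Y (le_trans (normFD _ _))// /c3 mulrDl mul1r; apply: lerD.
  rewrite -[leRHS]mulrA.
  exact: le_trans (Zv_le _ tt) (ler_wpM2l cZ_ge0 (phile _)).
exact: F_le.
Qed.

(** * Almost periodicity of bounded solutions *)

Section almost_periodicity.
Context {y : R -> 'cV[C]_q} {M : R}.
Hypothesis sol_y : is_solution tn A B f y.
Hypothesis y_le : forall t, normF (y t) <= M.

Let M_ge0 : 0 <= M. Proof. exact: le_trans (normF_ge0 _) (y_le 0). Qed.

Let L : R := al * M + be * M + ph.
Let L_ge0 : 0 <= L.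
Proof. by rewrite !addr_ge0// mulr_ge0. Qed.

(** The equation bounds the derivative by [L] inside each interval; the finitely many intervals
    between [s] and [t] are chained at the switching times. *)
Lemma bounded_solution_lipschitz s t : s <= t -> normF (y t - y s) <= L * (t - s).
Proof.
have [cy [dy _]] := sol_y.
have piece n s' t' : tn n <= s' -> s' <= t' -> t' <= tn (n + 1) ->
    normF (y t' - y s') <= L * (t' - s').
  apply: (mean_value_le cy L_ge0 (dy n)) => u _.
  apply: (le_trans (normFD _ _)); apply: lerD => //.
  apply: (le_trans (normFD _ _)); apply: lerD; apply: (le_trans (normFM _ _));
    by apply: ler_pM; rewrite ?normF_ge0.
have chain (k : nat) : forall (n : int) (s t : R), tn n <= s <= tn (n + 1) ->
    tn (n + k%:Z) <= t <= tn (n + k%:Z + 1) -> s <= t -> normF (y t - y s) <= L * (t - s).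
  elim: k => [|k ih] n s' t' hs ht st.
    by rewrite addr0 in ht; apply: (piece n) => //; lra.
  set u := tn (n + k%:Z + 1).
  have uE : u = tn (n + k.+1%:Z) by rewrite /u; congr tn; clear; lia.
  have su : s' <= u.
    have : tn (n + 1) <= u by apply: (tn_nondecreasing tn_lt); clear; lia.
    lra.
  have un : tn (n + k%:Z) <= u <= tn (n + k%:Z + 1) by rewrite lexx ltW ?tn_lt.
  have ut : u <= t' by rewrite uE; lra.
  have h1 := ih n s' u hs un su.
  have h2 : normF (y t' - y u) <= L * (t' - u).
    by apply: (piece (n + k.+1%:Z)) => //; [rewrite uE|lra].
  rewrite -(subrK (y u) (y t')) -addrA (le_trans (normFD _ _))//.
  rewrite (_ : L * (t' - s') = L * (t' - u) + L * (u - s')); last by ring.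
  exact: lerD.
move=> st; have idx := tn_index tn_lt tn_pinfty tn_ninfty.
have [n hn] := idx s; have [m hm] := idx t.
have nm : n < m + 1 by apply: (tn_lt_index tn_lt); lra.
have mE : m = n + `|m - n|%N%:Z by clear -nm; lia.
by apply: (chain `|m - n|%N n); rewrite -?mE; lra.
Qed.

Let lip s t : normF (y t - y s) <= L * `|t - s|.
Proof.
have [st|ts] := lerP s t; first exact: bounded_solution_lipschitz.
by rewrite normFBC; apply: bounded_solution_lipschitz; exact: ltW.
Qed.

(** [Lp] is a Lipschitz constant of [Z n t *m v] for [|v| <= 2 * M], and [D] adds those of the two
    copies of [y]. In [rh], [2 * M] pays for the shifts of [A] and [B], [be * L] for the mismatch of
    the switching times, and [1] for the shift of [f]. *)
Let Lp : R := al * (cZ * (2 * M)) + be * (2 * M).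
Let D : R := 2 * L + Lp.
Let rh : R := 2 * M + be * L + 1.
Let Cd : R := K0 * (D + rh * th) + D.

Let Lp0 : 0 <= Lp.
Proof.
have M2 : 0 <= 2 * M by rewrite mulr_ge0.
exact: addr_ge0 (mulr_ge0 al_ge0 (mulr_ge0 cZ_ge0 M2)) (mulr_ge0 be_ge0 M2).
Qed.

Let D0 : 0 <= D.
Proof. exact: addr_ge0 (mulr_ge0 (ler0n R 2) L_ge0) Lp0. Qed.

Let rh0 : 0 <= rh.
Proof. exact: addr_ge0 (addr_ge0 (mulr_ge0 (ler0n R 2) M_ge0) (mulr_ge0 be_ge0 L_ge0)) (@ler01 R). Qed.

Section shift.
Context {e tau : R} {T : int}.
Hypothesis e_gt0 : 0 < e.
Hypothesis tauA : forall t, normF (A (t + tau) - A t) <= e.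
Hypothesis tauB : forall t, normF (B (t + tau) - B t) <= e.
Hypothesis tauf : forall t, normF (f (t + tau) - f t) <= e.
Hypothesis tauT : forall n, `|tn (n + T) - tn n - tau| <= e.

Let w t := y (t + tau) - y t.

Let w_le t : normF (w t) <= 2 * M.
Proof.
apply: (le_trans (normFB _ _)); rewrite mulr_natl mulr2n; exact: lerD.
Qed.

(** At distance more than [e] from both ends of the interval, [s + tau] lies in the interval of
    index [n + T], so both equations hold with known delayed arguments and can be subtracted. *)
Let shift_piece n t : tn n <= t <= tn (n + 1) ->
  normF (w t - Z n t *m w (tn n)) <= Cd * e.
Proof.
move=> tnt; have [cy [dy _]] := sol_y.
set v := w (tn n).
pose d s := w s - Z n s *m v.
have cw : mcont w by apply: mcontB => //; exact: mcont_shift.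
have cd : mcont d by apply: mcontB.
have d0 : d (tn n) = 0 by rewrite /d Z1 mul1mx subrr.
have lipd s u : tn n <= s -> s <= u -> u <= tn (n + 1) ->
    normF (d u - d s) <= D * (u - s).
  move=> ns su un.
  have h1 := lip (s + tau) (u + tau); have h2 := lip s u.
  rewrite (_ : u + tau - (s + tau) = u - s) in h1; last by ring.
  rewrite ger0_norm ?subr_ge0// in h1 h2.
  have h3 : normF (Z n u *m v - Z n s *m v) <= Lp * (u - s).
    apply: (mean_value_le (cZv n v) Lp0 (fun x _ => dZv n v x) _ ns su un) => x xn.
    apply: (le_trans (normFD _ _)); apply: lerD; apply: (le_trans (normFM _ _)).
      have xn' : tn n <= x <= tn (n + 1) by lra.
      have Zle := le_trans (Zv_le v xn') (ler_wpM2l cZ_ge0 (w_le (tn n))).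
      exact: ler_pM (normF_ge0 _) (normF_ge0 _) (A_le x) Zle.
    exact: ler_pM (normF_ge0 _) (normF_ge0 _) (B_le x) (w_le (tn n)).
  have -> : d u - d s = (y (u + tau) - y (s + tau)) - (y u - y s) -
      (Z n u *m v - Z n s *m v).
    by rewrite /d /w; apply/matrixP => i j; rewrite !mxE; ring.
  apply: (le_trans (normFB _ _)).
  rewrite (_ : D * (u - s) = L * (u - s) + L * (u - s) + Lp * (u - s)); last by rewrite /D; ring.
  apply: lerD => //; apply: (le_trans (normFB _ _)); exact: lerD.
(* The third term arises because the shifted equation evaluates [y] at [tn (n + T)], whereas
   [w (tn n)] involves [y (tn n + tau)]. *)
pose r t := (A (t + tau) - A t) *m y (t + tau) + (B (t + tau) - B t) *m y (tn (n + T)) +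
  B t *m (y (tn (n + T)) - y (tn n + tau)) + (f (t + tau) - f t).
have dd s : tn n + e < s < tn (n + 1) - e -> has_deriv d s (A s *m d s + r s).
  move=> tne.
  have t1 : tn n < s < tn (n + 1) by move: e_gt0; lra.
  have t2 : tn (n + T) < s + tau < tn (n + T + 1).
    have := tauT n; have := tauT (n + 1); rewrite [n + 1 + T]addrAC !ler_norml; lra.
  have := has_derivB (has_derivB (has_deriv_shift (dy _ _ t2)) (dy _ _ t1)) (dZv n v s).
  congr (has_deriv _ _ _); rewrite /d /r.
  have -> : B s *m v = B s *m y (tn n + tau) - B s *m y (tn n) by rewrite -mulmxBr.
  rewrite !mulmxBl !mulmxBr.
  move: (A (s + tau) *m y (s + tau)) (B (s + tau) *m y (tn (n + T))) (A s *m y (s + tau))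
    (A s *m y s) (B s *m y (tn n)) (B s *m y (tn n + tau)) (B s *m y (tn (n + T)))
    (A s *m (Z n s *m v)) (f (s + tau)) (f s) => a1 a2 a3 a4 a5 a6 a7 a8 a9 a10.
  by clear; apply/matrixP => i j; rewrite !mxE; ring.
have rle s : tn n + e < s < tn (n + 1) - e -> normF (r s) <= rh * e.
  move=> _.
  have h1 : normF ((A (s + tau) - A s) *m y (s + tau)) <= e * M.
    by apply: (le_trans (normFM _ _)); apply: ler_pM => //; exact: normF_ge0.
  have h2 : normF ((B (s + tau) - B s) *m y (tn (n + T))) <= e * M.
    by apply: (le_trans (normFM _ _)); apply: ler_pM => //; exact: normF_ge0.
  have h3 : normF (B s *m (y (tn (n + T)) - y (tn n + tau))) <= be * (L * e).
    apply: (le_trans (normFM _ _)); apply: ler_pM => //; try exact: normF_ge0.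
    apply: (le_trans (lip _ _)); apply: ler_wpM2l => //.
    by rewrite opprD addrA; exact: tauT.
  rewrite (_ : rh * e = e * M + e * M + be * (L * e) + e); last by rewrite /rh; ring.
  rewrite /r; apply: (le_trans (normFD _ _)); apply: lerD; last exact: tauf.
  apply: (le_trans (normFD _ _)); apply: lerD h3.
  exact: le_trans (normFD _ _) (lerD h1 h2).
have rhe : 0 <= rh * e by apply: mulr_ge0 => //; exact: ltW.
have := linear_solution_collar_le A_le th_ge0 cd d0 (gap_le n) e_gt0 D0 rhe lipd dd rle tnt.
move=> h; apply: (le_trans h); rewrite -/K0 /Cd.
by rewrite le_eqVlt; apply/orP; left; apply/eqP; ring.
Qed.

(** Sampled at the switching times, [w] satisfies the difference equation with forcing at most
    [Cd * e]; the dichotomy bounds the samples, and [shift_piece] fills in the values between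
    them. *)
Lemma shift_le t : normF (y (t + tau) - y t) <= c3 * Cd * e.
Proof.
pose wn n := w (tn n).
pose h n := wn (n + 1) - Z n (tn (n + 1)) *m wn n.
have hle n : normF (h n) <= Cd * e.
  by apply: shift_piece; rewrite lexx andbT ltW.
have wrec n : wn (n + 1) = Hn tn X B n *m wn n + h n.
  by rewrite HZ /h [RHS]addrC subrK.
have wle n : normF (wn n) <= 2 * M by exact: w_le.
have wn_le := bounded_solution_le Phi_unit Phi_rec K_gt0 rho01 Green_le wrec wle hle.
have [n /andP[nt tn1]] := tn_index tn_lt tn_pinfty tn_ninfty t.
have tt : tn n <= t <= tn (n + 1) by rewrite nt ltW.
rewrite -/(w t) -(subrK (Z n t *m wn n) (w t)) (le_trans (normFD _ _))//.
rewrite (_ : c3 * Cd * e = Cd * e + cZ * (2 * K / (1 - rho) * (Cd * e))); last first.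
  by rewrite /c3; ring.
apply: lerD; first exact: shift_piece.
exact: le_trans (Zv_le _ tt) (ler_wpM2l cZ_ge0 (wn_le n)).
Qed.

End shift.

Lemma bounded_solution_almost_periodic : almost_periodic y.
Proof.
split; first by case: sol_y.
move=> eps e0.
have c0 : 0 <= c3 * Cd.
  have r1 : 0 <= 2 * K / (1 - rho).
    by apply: divr_ge0; [apply: mulr_ge0 => //; exact: ltW|have /andP[] := rho01; lra].
  apply: mulr_ge0; first by rewrite /c3 addr_ge0// mulr_ge0.
  by rewrite /Cd addr_ge0// mulr_ge0// addr_ge0// mulr_ge0.
pose e := eps / (c3 * Cd + 1).
have e_gt0 : 0 < e by rewrite divr_gt0// ltr_wpDl.
have [dense _ _] := translation_familyI
  (translation_familyI (almost_periodic_translation_family apA)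
                       (almost_periodic_translation_family apB))
  (translation_familyI (almost_periodic_translation_family apf)
                       (tn_translation_family tn_lt tn_pinfty tn_ninfty f_H3.1)).
have [l l0 hl] := dense _ e_gt0; exists l => // m.
have [tau [[tA tB] [tf [T tT]]] taul] := hl m; exists tau => // t.
apply: (le_trans (shift_le e_gt0 tA tB tf tT t)).
rewrite /e mulrA ler_pdivrMr ?ltr_wpDl// mulrC; apply: ler_wpM2l; first exact: ltW.
by rewrite lerDl.
Qed.

End almost_periodicity.
End piecewise.

(** * Finite suprema and the theorem *)

(** The range is nonempty and bounded above, so its supremum is finite and [fine] returns the true
    value rather than its default. *)
Lemma ereal_sup_range_fine (R : realType) (T : Type) (u : T -> R) (x0 : T) (M : R) :
  (forall t, u t <= M) ->
  ereal_sup (range (fun t => (u t)%:E)) = (fine (ereal_sup (range (fun t => (u t)%:E))))%:E.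
Proof.
move=> uM; rewrite fineK// fin_numElt; apply/andP; split.
  apply: (@lt_le_trans _ _ (u x0)%:E); first exact: ltNyr.
  by apply: ereal_sup_ubound; exists x0.
apply: (@le_lt_trans _ _ M%:E); last exact: ltry.
by apply: ge_ereal_sup => _ [t _ <-]; rewrite lee_fin.
Qed.

Lemma le_fine_ereal_sup_range (R : realType) (T : Type) (u : T -> R) (M : R) :
  (forall t, u t <= M) -> forall t, u t <= fine (ereal_sup (range (fun t => (u t)%:E))).
Proof.
move=> uM t; rewrite -lee_fin -(ereal_sup_range_fine t uM).
by apply: ereal_sup_ubound; exists t.
Qed.

Theorem theorem2 (R : realType) (q : nat) (tn : int -> R)
  (A B : R -> 'M[R[i]]_q) (f : R -> 'cV[R[i]]_q)
  (X : R -> 'M[R[i]]_q) (Phi : int -> 'M[R[i]]_q)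
  (Pi : 'M[R[i]]_q) (K rho : R) :
  (* the sequence (t_n) *)
  (forall n : int, tn n < tn (n + 1)) ->
  (forall M : R, exists N : int, forall n : int, N <= n -> M <= tn n) ->
  (forall M : R, exists N : int, forall n : int, n <= N -> tn n <= M) ->
  (* standing assumptions *)
  loc_integrable A -> loc_integrable B -> loc_integrable f ->
  (* X is a fundamental matrix of x' = A(t) x *)
  (forall t, X t \in unitmx) ->
  (forall t, has_deriv X t (A t *m X t)) ->
  (* J_n(t) invertible *)
  (forall (n : int) (t : R), tn n <= t <= tn (n + 1) -> Jn tn X B n t \in unitmx) ->
  (* Phi is a fundamental matrix of phi(n+1) = H(n) phi(n) *)
  (forall n : int, Phi n \in unitmx) ->
  (forall n : int, Phi (n + 1) = Hn tn X B n *m Phi n) ->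
  (* (H1) *)
  almost_periodic A -> almost_periodic B ->
  (* (H3) *)
  H3 tn f ->
  (* (H6) *)
  Pi *m Pi = Pi -> 0 < K -> 0 < rho -> rho < 1 ->
  (forall n k : int, normF (Green Phi Pi n k) <= K * rho ^+ `|n - k|%N) ->
  (* conclusion *)
  let th := theta tn in
  let K0 := expR (supnorm A * th) in
  let K3 := (Num.sqrt (q%:R) * K0 * (1 + supnorm B * th) * (2 * K / (1 - rho)) + 1)
            * Num.sqrt (q%:R) * K0 * th in
  exists y : R -> 'cV[R[i]]_q,
    [/\ is_solution tn A B f y, almost_periodic y,
        (forall z, is_solution tn A B f z -> almost_periodic z -> z = y) &
        (supnormE y <= K3%:E * supnormE f)%E].
Proof.
move=> tn_lt tn_pinfty tn_ninfty _ _ _ X_unit dX _ Phi_unit Phi_rec apA apB f_H3 _.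
move=> K_gt0 rho_gt0 rho_lt1 Green_le th K0 K3.
have rho01 : 0 < rho < 1 by rewrite rho_gt0.
have [MA hMA] := almost_periodic_bounded apA.
have [MB hMB] := almost_periodic_bounded apB.
have apf : almost_periodic f.
  exact: (H3_almost_periodic tn_lt tn_pinfty tn_ninfty f_H3.1 f_H3).
have [Mf hMf] := almost_periodic_bounded apf.
have A_le t : normF (A t) <= supnorm A := le_fine_ereal_sup_range hMA t.
have B_le t : normF (B t) <= supnorm B := le_fine_ereal_sup_range hMB t.
have f_le t : normF (f t) <= supnorm f := le_fine_ereal_sup_range hMf t.
have [g hg] := tn_gap_bounded tn_lt f_H3.1.
have gap_le n : tn (n + 1) - tn n <= th := le_fine_ereal_sup_range hg n.
have [Z [dZ Z1 HZ]] := Zn_extension tn_lt X_unit dX apB.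
have [F [dF F0]] := forced_extension tn_lt tn_pinfty tn_ninfty X_unit dX f_H3.
have [y sol_y y_le] := bounded_solution_construction tn_lt tn_pinfty tn_ninfty
  Phi_unit Phi_rec K_gt0 rho01 Green_le A_le B_le f_le gap_le dZ Z1 HZ dF F0.
have ap_y : almost_periodic y.
  exact: (bounded_solution_almost_periodic tn_lt tn_pinfty tn_ninfty Phi_unit Phi_rec
    apA apB f_H3 K_gt0 rho01 Green_le A_le B_le f_le gap_le dZ Z1 HZ sol_y y_le).
exists y; split => //.
  move=> z sol_z ap_z.
  apply: (bounded_solution_unique tn_lt tn_pinfty tn_ninfty Phi_unit Phi_rec
    K_gt0 rho01 Green_le A_le gap_le dZ Z1 HZ dF F0 sol_y sol_z).
    exact: almost_periodic_bounded.
  exact: almost_periodic_bounded.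
have -> : supnormE f = (supnorm f)%:E := ereal_sup_range_fine 0 hMf.
rewrite -EFinM; apply: ge_ereal_sup => _ [t _ <-]; rewrite lee_fin.
have th0 : 0 <= th by have := gap_le 0; have := tn_lt 0; lra.
have f0 : 0 <= supnorm f := le_trans (normF_ge0 _) (f_le 0).
have B0 : 0 <= supnorm B := le_trans (normF_ge0 _) (B_le 0).
(* For [q = 0] the inequality [sqrt q >= 1] fails and [K3] vanishes, but so does every vector. *)
have [q0|q_gt0] := posnP q.
  rewrite /normF /K3 big1 ?sqrtr0; last by move=> i _; exfalso; case: i; rewrite q0.
  have -> : Num.sqrt (q%:R : R) = 0 by rewrite q0 sqrtr0.
  by rewrite !mulr0 !mul0r.
have s1 : 1 <= Num.sqrt (q%:R : R) by rewrite -[leLHS]sqrtr1; apply: ler_wsqrtr; rewrite ler1n.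
apply: (le_trans (y_le t)).
rewrite -/th -/K0; set s := Num.sqrt _ in s1 *.
set a := K0 * (1 + _); set b := 2 * K / _.
have a0 : 0 <= a by rewrite /a mulr_ge0 ?expR_ge0// addr_ge0// mulr_ge0.
have b0 : 0 <= b by rewrite /b divr_ge0 ?mulr_ge0 ?(ltW K_gt0)// subr_ge0 ltW.
have K0_ge0 : 0 <= K0 := expR_ge0 _.
rewrite (_ : K3 * supnorm f = (s * (a * b) + 1) * s * (K0 * (supnorm f * th))); last first.
  by rewrite /K3 /a /b /s; ring.
apply: ler_wpM2r; first by rewrite !mulr_ge0.
(* The bound proved has [a * b + 1] in place of [(s * (a * b) + 1) * s]; both occurrences of [s]
   only enlarge it. *)
have ab : a * b <= s * (a * b) by rewrite ler_peMl// mulr_ge0.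
apply: (@le_trans _ _ (s * (a * b) + 1)); first by rewrite lerD2r.
have s0 : 0 <= s by rewrite (le_trans ler01).
by apply: ler_peMr => //; apply: addr_ge0 => //; exact: (mulr_ge0 s0 (mulr_ge0 a0 b0)).
Qed.
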